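(* Let $S$ be a dense subgroup of $(\mathbb{R},+)$, let $b\in S_{>0}\cup\{\infty\}$, let $\mathcal{U}$ be an $\mathcal{S}_b$-Urysohn space and $G=\mathrm{Isom}(\mathcal{U})$. Then there are exactly four group topologies on $G$ coarser than $\tau_{st}$, namely $$\tau_{st}\supsetneq\tau_{0^{+},0}\supsetneq\tau_{m}\supsetneq\{\emptyset,G\},$$ where $\tau_{0^{+},0}$ is the group topology generated at the identity by the collection $\{\{g\in G: d(gu,v)=d(u,v)\}: u,v\in\mathcal{U},\ d(u,v)>0\}$.
   Context: $\mathcal{S}_b$ is the distance monoid with underlying set $\{r\in S: 0\leq r\leq b\}$, the usual order, $0$, and the operation $x+_b y=\min\{x+y,b\}$ (ordinary addition if $b=\infty$). An $\mathcal{S}_b$-metric space is a set with a distance function into this set satisfying the metric axioms with $+_b$ in the triangle inequality. An $\mathcal{S}_b$-Urysohn space is an $\mathcal{S}_b$-metric space into which every finite $\mathcal{S}_b$-metric space embeds isometrically and in which every isometry between finite subspaces extends to a global isometry. $\tau_{st}$ is the group topology on $G$ with base of identity neighbourhoods the pointwise stabilizers $G_A$ of finite $A\subseteq\mathcal{U}$; $\tau_m$ is the pointwise convergence topology, generated at the identity by $N_u(\epsilon)=\{g\in G: d(gu,u)\leq\epsilon\}$ for $u\in\mathcal{U}$, $\epsilon\in S$, $0<\epsilon\leq b$.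
   Formalization: For finite b the sets {g: d(gu,v)=d(u,v)} with d(u,v)=b stop finite intersections from being a base at 1 of a group topology; ''generated at the identity'' is read as the finest group topology whose identity neighbourhoods each contain a finite intersection of the given sets. *)

(* Defs.v *)
From HB Require Import structures.
From mathcomp Require Import all_boot all_order all_algebra.
From mathcomp Require Import all_classical all_reals all_analysis.

Set Implicit Arguments.
Unset Strict Implicit.
Unset Printing Implicit Defensive.

Import Order.TTheory GRing.Theory Num.Theory.
Import numFieldNormedType.Exports.

Local Open Scope classical_set_scope.
Local Open Scope ring_scope.

Section Distances.
Context {R : realType}.

Definition Sb (S : set R) (b : \bar R) : set R :=
  [set r | S r /\ (0 <= r%:E <= b)%E].

Definition addb (b : \bar R) (x y : R) : R :=
  if b is b0%:E then Num.min (x + y) b0 else x + y.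

Record metricSpace (S : set R) (b : \bar R) := MetricSpace {
  mpoint :> Type;
  dist : mpoint -> mpoint -> R;
  dist_in : forall x y, Sb S b (dist x y);
  dist_eq0 : forall x y, dist x y = 0 <-> x = y;
  distC : forall x y, dist x y = dist y x;
  dist_triangle : forall x y z, dist x z <= addb b (dist x y) (dist y z)
}.

Record Isom {S : set R} {b : \bar R} (U : metricSpace S b) := MkIsom {
  isometry_fun :> U -> U;
  isometry_dist : forall x y, dist (isometry_fun x) (isometry_fun y) = dist x y;
  isometry_bij : bijective isometry_fun
}.

Definition urysohn {S : set R} {b : \bar R} (U : metricSpace S b) : Prop :=
  (forall X : metricSpace S b, finite_set [set: X] ->
     exists f : X -> U, forall x y, dist (f x) (f y) = dist x y) /\
  (forall (A : set U) (f : U -> U), finite_set A ->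
     (forall x y, A x -> A y -> dist (f x) (f y) = dist x y) ->
     exists g : Isom U, forall x, A x -> g x = f x).

End Distances.

Section IsometryGroup.
Context {R : realType} {S : set R} {b : \bar R} (U : metricSpace S b).
Implicit Types g h : Isom U.

Lemma isometryP g h : (forall x, g x = h x) -> g = h.
Proof.
case: g h => [g gd gb] [h hd hb] /= /funext gh.
by move: gd gb hd hb; rewrite gh => *; congr MkIsom; exact: Prop_irrelevance.
Qed.

Definition isometry_one : Isom U :=
  @MkIsom _ _ _ U id (fun _ _ => erefl) (Bijective (frefl _) (frefl _)).

Definition isometry_mul g h : Isom U :=
  @MkIsom _ _ _ U (g \o h)
    (fun x y => etrans (isometry_dist g (h x) (h y)) (isometry_dist h x y))
    (bij_comp (isometry_bij g) (isometry_bij h)).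

Lemma isometry_inv_subproof g : exists h, cancel h g /\ cancel g h.
Proof.
have [f gK fK] := isometry_bij g.
have fd x y : dist (f x) (f y) = dist x y by rewrite -(isometry_dist g) !fK.
by exists (MkIsom fd (Bijective fK gK)).
Qed.

Definition isometry_inv g : Isom U := projT1 (cid (isometry_inv_subproof g)).

Lemma isometry_invK g : cancel (isometry_inv g) g.
Proof. by rewrite /isometry_inv; case: cid => h []. Qed.

Lemma isometry_invVK g : cancel g (isometry_inv g).
Proof. by rewrite /isometry_inv; case: cid => h []. Qed.

HB.instance Definition _ := gen_eqMixin (Isom U).
HB.instance Definition _ := gen_choiceMixin (Isom U).

Let mulA : associative isometry_mul.
Proof. by move=> f g h; exact: isometryP. Qed.
Let mul1 : left_id isometry_one isometry_mul.
Proof. by move=> g; exact: isometryP. Qed.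
Let mulr1 : right_id isometry_one isometry_mul.
Proof. by move=> g; exact: isometryP. Qed.
Let mulV : left_inverse isometry_one isometry_inv isometry_mul.
Proof. by move=> g; apply: isometryP => x; exact: isometry_invVK. Qed.
Let mulrV : right_inverse isometry_one isometry_inv isometry_mul.
Proof. by move=> g; apply: isometryP => x; exact: isometry_invK. Qed.

HB.instance Definition _ :=
  isGroup.Build (Isom U) mulA mul1 mulr1 mulV mulrV.

End IsometryGroup.

(* Topologies are handled as families of open sets, so that several of them   *)
(* can be compared on one group; topologized equips (an alias of) the group   *)
(* with the corresponding topologicalType structure.                          *)
Record is_topology {T : Type} (O : set_system T) : Prop := IsTopology {
  is_topologyT : O setT;
  is_topologyI : setI_closed O;
  is_topology_bigcup : forall (I : Type) (f : I -> set T),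
    (forall i, O (f i)) -> O (\bigcup_i f i)
}.

Definition topologized (G : groupType) (O : set_system G)
  of is_topology O : Type := G.

Section Topologized.
Context (G : groupType) (O : set_system G) (Otop : is_topology O).
HB.instance Definition _ := Group.copy (topologized Otop) G.
HB.instance Definition _ := isOpenTopological.Build (topologized Otop)
  (is_topologyT Otop) (is_topologyI Otop) (@is_topology_bigcup _ _ Otop).
End Topologized.

Definition group_topology_axiom (G : groupType) (O : set_system G)
    (Otop : is_topology O) : Prop :=
  continuous (fun p : topologized Otop * topologized Otop => (p.1 * p.2)%g) /\
  continuous (fun g : topologized Otop => (g^-1)%g).

Definition group_topology (G : groupType) (O : set_system G) : Prop :=
  exists Otop : is_topology O, group_topology_axiom Otop.

(* The family of open sets for which B is a base at the identity.             *)
Definition topology_of_base (G : groupType) (B : set_system G) : set_system G :=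
  [set W | forall g, W g -> exists2 V, B V & forall h, V h -> W (g * h)%g].

Definition generated_filter (T : Type) (C : set_system T) : set_system T :=
  smallest (@Filter T) C.

(* The finest group topology in which the filter generated by C converges to  *)
(* 1, i.e. all of whose identity neighbourhoods contain a finite intersection *)
(* of members of C (group topologies with this property are closed under      *)
(* suprema, so their union is again one of them). If the finite intersections *)
(* of members of C form a base at 1 of a group topology, it is that topology: *)
(* see generated_topologyE. It also makes sense when they do not, as happens  *)
(* for stationary_sets below when b is finite: for d(u, v) = b the set        *)
(* {g | d(g u, v) = d(u, v)} contains no V * V with V a finite intersection   *)
(* of members.                                                                *)
Definition generated_topology (G : groupType) (C : set_system G) :
    set_system G :=
  \bigcup_(O in [set O | exists Otop : is_topology O,
                   group_topology_axiom Otop /\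
                   generated_filter C --> (1%g : topologized Otop)]) O.

Lemma generated_topologyE (G : groupType) (C O : set_system G)
    (Otop : is_topology O) :
  group_topology_axiom Otop ->
  nbhs (1%g : topologized Otop) = generated_filter C ->
  generated_topology C = O.
Proof.
have nbhsM (P : set_system G) (Ptop : is_topology P) : group_topology_axiom Ptop ->
    forall (g h : topologized Ptop) (W : set (topologized Ptop)),
    nbhs (g * h)%g W -> nbhs h [set k | W (g * k)%g].
  move=> [mulC _] g h W /(mulC (g, h))[[A B] /= [nA nB] AB].
  by apply: filterS nB => k Bk; apply: (AB (g, k)); split=> //=; exact: nbhs_singleton.
move=> Ogrp nbhs1; apply/seteqP; split=> [W [P [Ptop [Pgrp P1]] PW]|W OW]; last first.
  by exists O => //; exists Otop; split=> //; rewrite -nbhs1; exact: cvg_id.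
suff: @open (topologized Otop) W by [].
rewrite openE => g Wg.
have : @nbhs _ (topologized Otop) 1%g [set k | W (g * k)%g].
  rewrite nbhs1; apply: P1; apply: (nbhsM _ _ Pgrp).
  by rewrite mulg1; apply: (@open_nbhs_nbhs (topologized Ptop)); split.
rewrite -[1%g](mulVg g) => /(nbhsM _ _ Ogrp) /=.
by apply: filterS => k /=; rewrite mulVKg.
Qed.

Section IsometryTopologies.
Context {R : realType} {S : set R} {b : \bar R} (U : metricSpace S b).

Definition stabilizer (A : set U) : set (Isom U) :=
  [set g | forall x, A x -> g x = x].

Definition tau_st : set_system (Isom U) :=
  topology_of_base [set stabilizer A | A in [set A | finite_set A]].

Definition small_moves : set_system (Isom U) :=
  [set N | exists (u : U) (e : R), [/\ S e, 0 < e, (e%:E <= b)%E &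
     N = [set g : Isom U | dist (g u) u <= e]]].

Definition tau_m : set_system (Isom U) := generated_topology small_moves.

Definition stationary_sets : set_system (Isom U) :=
  [set N | exists u v : U, 0 < dist u v /\
     N = [set g : Isom U | dist (g u) v = dist u v]].

Definition tau_0p0 : set_system (Isom U) :=
  generated_topology stationary_sets.

End IsometryTopologies.

Arguments tau_st {R S b} U.
Arguments tau_m {R S b} U.
Arguments tau_0p0 {R S b} U.

(* Main.v *)
Require Import Defs.
From HB Require Import structures.
From mathcomp Require Import all_boot all_order all_algebra.
From mathcomp Require Import all_classical all_reals all_analysis.
From mathcomp Require Import lra.
Import Order.TTheory GRing.Theory Num.Theory.
Import numFieldNormedType.Exports.
Local Open Scope classical_set_scope.
Local Open Scope ring_scope.

(* A group topology is determined by its filter F of identity neighbourhoods,  *)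
(* and it is coarser than tau_st when each member of F contains the pointwise  *)
(* stabilizer G_A of a finite set A. By homogeneity and amalgamation, k lies   *)
(* in G_A h G_A h^-1 G_A as soon as                                            *)
(*   |d(a, hc) - d(a', hc)| <= d(a, ka') <= d(a, hc) + d(a', hc)               *)
(* for a, a', c in A. So if the members of F contain elements h moving any     *)
(* given finite set A into sufficiently general position, they are large.      *)
(* - If some {g | d(gu, u) <= e} is not in F, all distances from h A to A can   *)
(*   be made equal and arbitrarily large, and F is trivial.                    *)
(* - Otherwise F contains the filter of tau_m. If some {g | d(gu, v) = d(u, v)} *)
(*   with 0 < d(u, v) < b is not in F, then h can be taken such that all        *)
(*   triangle inequalities involving two points of A and a point of h A are    *)
(*   strict, and F is the filter of tau_m.                                     *)
(* - Otherwise F contains the filter of tau_{0+,0}. If some G_u is not in F,   *)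
(*   then h A can be made disjoint from A, and F is the filter of tau_{0+,0}.  *)
(* - Otherwise F is the filter of tau_st.                                      *)
(* The elements h are obtained first for one point, then for all of A by       *)
(* multiplying by elements of stabilizers in free position; products           *)
(* h^-1 f h with f in a stabilizer then improve their position.                *)

Set Implicit Arguments.
Unset Strict Implicit.
Unset Printing Implicit Defensive.

(** * Group topologies and their identity neighbourhoods *)

(** Group topologies and filters satisfying [group_filter] determine each other
    ([group_topology_filter], [topology_of_base_group_topology]), inclusions included
    ([topology_of_base_sub]). The theorem thus becomes a classification of the group filters inside
    [st_filter], which is [coarse_filters].

    All isometries are produced by [amalgam]: prescribe the distances between a moved finite set and
    another one, and check triangle inequalities. This yields [five_fold_product], hence
    [coarse_double_coset]: one element of a small neighbourhood that moves [A] into good position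
    forces many elements into a larger one. Three lemmas exploit it, according to the first kind of
    basic set missing from the filter: [coarse_trivial] (small moves), [coarse_half_generic] with
    [coarse_of_half_generic] (stationary sets), [coarse_not_stabilizer] (stabilizers).

    The inclusions are strict because of the isometries of [shift_isometry], which alter every
    distance between [A] and its image by one function of the distance. For finite b the
    classification also serves to identify the third topology: among the group filters it is the
    largest one inside the filter generated by the stationary sets ([tau_0p0E]). *)

Record group_filter (G : groupType) (F : set_system G) : Prop := GroupFilter {
  group_filter_filter : Filter F;
  group_filter1 : forall W, F W -> W 1%g;
  group_filterM : forall W, F W ->
    exists2 V, F V & forall g h, V g -> V h -> W (g * h)%g;
  group_filterV : forall W, F W -> F [set g | W (g^-1)%g];
  group_filterJ : forall W g, F W -> F [set h | W (g * h * g^-1)%g]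
}.

Section GroupFilters.
Context (G : groupType).
Implicit Types W V : set G.
Implicit Types (F : set_system G) (O : set_system G).

Lemma group_filterM3 F : group_filter F -> forall W, F W ->
  exists V, [/\ F V, (forall g, V g -> V (g^-1)%g) &
    forall f g h, V f -> V g -> V h -> W (f * g * h)%g].
Proof.
move=> gF W /(group_filterM gF)[V1 /(group_filterM gF)[V2 FV2 V21] V1W].
have FF := group_filter_filter gF.
exists (V2 `&` [set g | V2 (g^-1)%g]); split.
- by apply: filterI => //; exact: (group_filterV gF FV2).
- by move=> g [? ?]; split=> //=; rewrite invgK.
- move=> f g h [Vf _] [Vg _] [Vh _]; apply: V1W; first exact: V21.
  by rewrite -(mulg1 h); apply: V21 => //; exact: (group_filter1 gF).
Qed.

Lemma topology_of_base_is_topology F : group_filter F ->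
  is_topology (topology_of_base F).
Proof.
move=> gF; have FF := group_filter_filter gF; split.
- by move=> g _; exists setT => //; exact: filterT.
- move=> A B OA OB g [/OA[V FV VA] /OB[V' FV' VB]].
  exists (V `&` V'); first exact: filterI.
  by move=> h [Vh V'h]; split; [exact: VA|exact: VB].
- move=> I f Of g [i _ /(Of i)[V FV Vf]]; exists V => // h /Vf ?.
  by exists i.
Qed.

Lemma topology_of_base_nbhs F (gF : group_filter F) (g : G) (W : set G) :
  @nbhs _ (topologized (topology_of_base_is_topology gF)) g W <->
  F [set h | W (g * h)%g].
Proof.
have FF := group_filter_filter gF.
rewrite nbhsE; split=> [[B [oB Bg] BW]|FW].
  have [V FV VB] : exists2 V, F V & forall h, V h -> B (g * h)%g by exact: oB.
  by apply: filterS FV => h /VB /BW.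
(* This set is the interior of [W]; that it is open is the axiom [group_filterM]. *)
have oW : topology_of_base F [set k | F [set h | W (k * h)%g]].
  move=> k /= /(group_filterM gF)[V FV VW].
  exists V => // h Vh; apply: filterS FV => h' Vh' /=.
  by rewrite -mulgA; exact: VW.
exists [set k | F [set h | W (k * h)%g]]; first by split; [exact: oW|].
by move=> k /= /(group_filter1 gF) /=; rewrite mulg1.
Qed.

Lemma topology_of_base_group_topology F (gF : group_filter F) :
  group_topology_axiom (topology_of_base_is_topology gF).
Proof.
have FF := group_filter_filter gF; set Ot := topology_of_base_is_topology gF.
split.
  move=> [g h] W /topology_of_base_nbhs /= FW.
  have [V FV VW] := group_filterM gF FW.
  (* Writing k = g p and l = h q gives k l = g h (h^-1 p h) q, so p is constrained through its
     conjugate by h. *)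
  exists ([set k | V (h^-1 * (g^-1 * k) * h)%g], [set k | V (h^-1 * k)%g]).
    split; apply/topology_of_base_nbhs.
      have := group_filterJ gF (h^-1)%g FV; apply: filterS => k /=.
      by rewrite mulKg invgK.
    by apply: filterS FV => k /=; rewrite mulKg.
  move=> [k l] [/= Vk Vl]; have := VW _ _ Vk Vl => /=.
  by rewrite !mulgA !mulgK mulgV mul1g.
move=> g W /topology_of_base_nbhs /= FW; apply/topology_of_base_nbhs => /=.
have := group_filterJ gF g (group_filterV gF FW); apply: filterS => h /=.
by rewrite !invgM invgK !mulgA mulVg mul1g.
Qed.

Lemma topology_of_base_nbhs1 F (gF : group_filter F) :
  nbhs (1%g : topologized (topology_of_base_is_topology gF)) = F.
Proof.
have FF := group_filter_filter gF; apply/seteqP; split=> W.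
  by move/topology_of_base_nbhs; apply: filterS => h /=; rewrite mul1g.
move=> FW; apply/topology_of_base_nbhs.
by apply: filterS FW => h /=; rewrite mul1g.
Qed.

Lemma topology_of_base_sub F F' : group_filter F -> group_filter F' ->
  topology_of_base F `<=` topology_of_base F' <-> F `<=` F'.
Proof.
move=> gF gF'; have FF := group_filter_filter gF'; split=> [FF' W FW|FF' W OW g].
  have : nbhs (1%g : topologized (topology_of_base_is_topology gF)) W.
    by rewrite topology_of_base_nbhs1.
  rewrite nbhsE => -[B [/FF' oB /oB[V FV VB]] BW].
  by apply: filterS FV => h /VB; rewrite mul1g => /BW.
by move=> /OW[V FV VW]; exists V => //; exact: FF'.
Qed.

Lemma topology_of_base_proper F F' : group_filter F -> group_filter F' ->
  F `<=` F' -> ~ (F' `<=` F) -> topology_of_base F `<` topology_of_base F'.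
Proof.
move=> gF gF' FF' nFF'; rewrite properEneq; split; last first.
  exact/topology_of_base_sub.
by apply/eqP => e; apply: nFF'; apply/topology_of_base_sub => //; rewrite e.
Qed.

Lemma group_topology_filter O (Ot : is_topology O) : group_topology_axiom Ot ->
  group_filter (nbhs (1%g : topologized Ot)) /\
  O = topology_of_base (nbhs (1%g : topologized Ot)).
Proof.
move=> [mulc invc]; set F := nbhs _.
have mull (g h : topologized Ot) W : nbhs (g * h)%g W ->
    nbhs h [set k : topologized Ot | W (g * k)%g].
  move=> /(mulc (g, h))[[A B] /= [nA nB] AB].
  by apply: filterS nB => k Bk; apply: (AB (g, k)); split=> //=; exact: nbhs_singleton.
have mulr (g h : topologized Ot) W : nbhs (g * h)%g W ->
    nbhs g [set k : topologized Ot | W (k * h)%g].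
  move=> /(mulc (g, h))[[A B] /= [nA nB] AB].
  by apply: filterS nA => k Bk; apply: (AB (k, h)); split=> //=; exact: nbhs_singleton.
split; last first.
  apply/seteqP; split=> W OW.
    move=> g Wg; exists [set h | W (g * h)%g] => //.
    apply: mull; rewrite mulg1.
    by apply: (@open_nbhs_nbhs (topologized Ot)); split.
  suff: @open (topologized Ot) W by [].
  rewrite openE => g Wg; have [V FV VW] := OW _ Wg.
  have : @nbhs _ (topologized Ot) (g^-1 * g)%g V by rewrite mulVg.
  by move=> /mull; apply: filterS => k /VW; rewrite mulVKg.
split; first exact: nbhs_filter.
- by move=> W; exact: nbhs_singleton.
- move=> W FW.
  have /(mulc (1%g, 1%g))[[A B] /= [nA nB] AB] :
    nbhs (1 * 1 : topologized Ot)%g W by rewrite mulg1.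
  exists (A `&` B); first exact: filterI.
  by move=> g h [Ag _] [_ Bh]; exact: (AB (g, h)).
- by move=> W FW; apply: invc; rewrite invg1.
- move=> W g FW; apply: (mull g 1%g [set k | W (k * g^-1)%g]).
  by apply: mulr; rewrite mulg1 mulgV.
Qed.

Lemma set1T_group_filter : group_filter [set [set: G]].
Proof.
split.
- split=> //.
    by move=> A B -> ->; rewrite setTI.
  by move=> A B AB A1; apply/seteqP; split=> // x _; apply: AB; rewrite A1.
- by move=> W ->.
- by move=> W ->; exists setT.
- by move=> W ->.
- by move=> W g ->.
Qed.

Lemma topology_of_base_set1T :
  topology_of_base [set [set: G]] = [set set0; setT].
Proof.
apply/seteqP; split=> [W OW|W [->|->]]; last 2 first.
- by [].
- by move=> g _; exists setT.
have [->|/set0P[g Wg]] := eqVneq W set0; first by left.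
right; apply/seteqP; split=> // h _; have [V -> VW] := OW _ Wg.
by rewrite -(mulVKg g h); exact: VW.
Qed.

(** The filter generated by the [N i] (see [generated_subbase_filter]). Listing the indices of a
    finite intersection explicitly gives, for each member, a finite set of points to work with. *)
Definition subbase_filter (I : eqType) (P : I -> Prop) (N : I -> set G) : set_system G :=
  [set W | exists2 s : seq I, (forall i, i \in s -> P i) &
     forall g, (forall i, i \in s -> N i g) -> W g].

Section FiniteIntersections.
Context (I : eqType) (P : I -> Prop) (N : I -> set G).

Lemma subbase_filter_filter : Filter (subbase_filter P N).
Proof.
split.
- by exists [::].
- move=> A B [s Ps sA] [t Pt tB]; exists (s ++ t).
    by move=> i; rewrite mem_cat => /orP[/Ps|/Pt].
  move=> g Ng; split; [apply: sA => i si|apply: tB => i ti]; apply: Ng.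
    by rewrite mem_cat si.
  by rewrite mem_cat ti orbT.
- by move=> A B AB [s Ps sA]; exists s => // g /sA /AB.
Qed.

Lemma subbase_filter_gen i : P i -> subbase_filter P N (N i).
Proof. by move=> Pi; exists [:: i] => [j|g]; [move=> /predU1P[->|]|apply; exact: mem_head]. Qed.

Lemma subbase_filter_sub F : Filter F -> (forall i, P i -> F (N i)) ->
  subbase_filter P N `<=` F.
Proof.
move=> FF FN W [s]; elim: s W => [|i s IH] W Ps sW.
  by apply: filterS filterT => g _; exact: sW.
have Fi : F (N i) by apply: FN; apply: Ps; exact: mem_head.
have Fs : F [set g | forall j, j \in s -> N j g].
  by apply: IH => // j sj; apply: Ps; rewrite in_cons sj orbT.
by apply: filterS (filterI Fi Fs) => g [Ng sg]; apply: sW => j /predU1P[->|/sg].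
Qed.

Lemma generated_subbase_filter :
  generated_filter [set N i | i in P] = subbase_filter P N.
Proof.
apply/seteqP; split.
  apply: smallest_sub; first exact: subbase_filter_filter.
  by move=> _ [i Pi <-]; exact: subbase_filter_gen.
move=> W WF F [FF sF]; apply: (subbase_filter_sub FF) WF => i Pi.
by apply: sF; exists i.
Qed.

(** Each group axiom says that every member [W] belongs to another family, itself a filter: for
    products, the family of sets containing some V V with V in the filter. Hence it suffices to
    check generators. *)
Lemma subbase_group_filter :
  (forall i, P i -> N i 1%g) ->
  (forall i, P i -> exists2 V, subbase_filter P N V &
     forall g h, V g -> V h -> N i (g * h)%g) ->
  (forall i, P i -> subbase_filter P N [set g | N i (g^-1)%g]) ->
  (forall i g, P i -> subbase_filter P N [set h | N i (g * h * g^-1)%g]) ->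
  group_filter (subbase_filter P N).
Proof.
have FF := subbase_filter_filter.
have lift F : Filter F -> (forall i, P i -> F (N i)) ->
  forall W, subbase_filter P N W -> F W by exact: subbase_filter_sub.
move=> N1 NM NV NJ; split=> //.
- move=> W [s Ps]; apply=> i /Ps; exact: N1.
- apply: lift NM; split.
  + by exists setT => //; exact: filterT.
  + move=> A B [V FV VA] [V' FV' VB]; exists (V `&` V'); first exact: filterI.
    by move=> g h [? ?] [? ?]; split; [exact: VA|exact: VB].
  + by move=> A B AB [V FV VA]; exists V => // g h Vg Vh; exact/AB/VA.
- apply: lift NV; split => /=.
  + exact: filterT.
  + by move=> A B; exact: filterI.
  + by move=> A B AB; apply: filterS => g /AB.
- move=> W g; move: W; apply: lift; last by move=> i; exact: NJ.
  split => /=.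
  + exact: filterT.
  + by move=> A B; exact: filterI.
  + by move=> A B AB; apply: filterS => h /AB.
Qed.

End FiniteIntersections.
End GroupFilters.

(** * Amalgamation in the Urysohn space *)

Lemma addb_le (R : realType) (b : \bar R) (s t : R) : Defs.addb b s t <= s + t.
Proof. by case: b => [r||] //=; rewrite ge_min lexx. Qed.

(** Values bounded by b satisfy the truncated triangle inequality as soon as they satisfy the
    ordinary one, so later metric checks are linear inequalities. *)
Lemma le_addb (R : realType) (b : \bar R) (r s t : R) :
  (r%:E <= b)%E -> r <= s + t -> r <= Defs.addb b s t.
Proof. by case: b => [b0||] //=; rewrite lee_fin le_min => -> ->. Qed.

Section Amalgamation.
Context {R : realType} {S : set R} {b : \bar R} (U : metricSpace S b).

HB.instance Definition _ := gen_eqMixin (mpoint U).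
HB.instance Definition _ := gen_choiceMixin (mpoint U).

Implicit Types (x y z u v : U) (f g h : Isom U) (A C X Y : seq U).

Lemma dist_ge0 x y : 0 <= dist x y.
Proof. by have [_ /andP[]] := dist_in x y. Qed.

Lemma dist_le_b x y : ((dist x y)%:E <= b)%E.
Proof. by have [_ /andP[]] := dist_in x y. Qed.

Lemma distxx x : dist x x = 0.
Proof. exact/dist_eq0. Qed.

Lemma dist_gt0 x y : x != y -> 0 < dist x y.
Proof.
by move=> xy; rewrite lt0r dist_ge0 andbT; apply: contra xy => /eqP/dist_eq0/eqP.
Qed.

Lemma dist_tri y x z : dist x z <= dist x y + dist y z.
Proof. exact: le_trans (dist_triangle x y z) (addb_le _ _ _). Qed.

Lemma dist_isometry_inv g x y : dist ((g^-1)%g x) y = dist x (g y).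
Proof. by rewrite -(isometry_dist g) (isometry_invK g). Qed.

Lemma isometry_mulKV g x : g ((g^-1)%g x) = x.
Proof. exact: isometry_invK. Qed.

Lemma isometry_mulVK g x : (g^-1)%g (g x) = x.
Proof. exact: isometry_invVK. Qed.

Context (Ury : urysohn U).

Lemma homogeneous (I : Type) (u v : I -> U) : finite_set [set: I] ->
  (forall i j, dist (v i) (v j) = dist (u i) (u j)) ->
  exists g, forall i, g (u i) = v i.
Proof.
move=> Ifin uv.
(* The chosen index is irrelevant: u i = u j forces v i = v j, as [u] and [v] have the same
   distances. *)
pose p x := if pselect (exists i, u i = x) is left e then v (projT1 (cid e)) else x.
have pu i : p (u i) = v i.
  rewrite /p; case: pselect => [e|[]]; last by exists i.
  by case: cid => j /= uji; apply/dist_eq0; rewrite uv uji distxx.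
have [|x y [i _ <-] [j _ <-]|g gu] := Ury.2 (u @` setT) p.
- exact: finite_image.
- by rewrite !pu.
- by exists g => i; rewrite gu; [exact: pu|exists i].
Qed.

(** Amalgams may identify points, so pseudometrics have to be embedded too. The quotient consists of
    classes, taken as subsets of [T], with distances computed on chosen representatives. *)
Lemma pseudometric_embedding (T : Type) (D : T -> T -> R) :
  finite_set [set: T] -> (forall s t, Sb S b (D s t)) ->
  (forall t, D t t = 0) -> (forall s t, D s t = D t s) ->
  (forall t r s, D r s <= D r t + D t s) ->
  exists f : T -> U, forall s t, dist (f s) (f t) = D s t.
Proof.
move=> Tfin Din D0 Dsym Dtri.
have D_ge0 s t : 0 <= D s t by have [_ /andP[]] := Din s t.
pose cls t : set T := [set s | D t s = 0].
pose Q := {A : set T | exists t, A = cls t}.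
pose q t : Q := exist _ (cls t) (ex_intro _ t erefl).
pose p (A : Q) : T := projT1 (cid (svalP A)).
have pE (A : Q) : sval A = cls (p A) by rewrite /p; case: cid.
have Qinj (A B : Q) : sval A = sval B -> A = B.
  by case: A B => [A ?] [B ?] /= AB; exact: eq_exist.
have pq t : D t (p (q t)) = 0.
  suff: cls t (p (q t)) by [].
  by have /= -> := pE (q t); exact: D0.
have DQin (A B : Q) : Sb S b (D (p A) (p B)) by [].
have DQ0 (A B : Q) : D (p A) (p B) = 0 <-> A = B.
  split=> [DAB|->//]; apply: Qinj; rewrite !pE.
  apply/seteqP; split=> t /= Dt; apply/eqP; rewrite eq_le D_ge0 andbT.
    by apply: le_trans (Dtri (p A) _ _) _; rewrite Dsym DAB Dt addr0.
  by apply: le_trans (Dtri (p B) _ _) _; rewrite DAB Dt addr0.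
have DQtri (A B C : Q) : D (p A) (p C) <= Defs.addb b (D (p A) (p B)) (D (p B) (p C)).
  by have [_ /andP[_ Db]] := Din (p A) (p C); exact: le_addb.
pose M := MetricSpace DQin DQ0 (fun A B : Q => Dsym _ _) DQtri.
have Mfin : finite_set [set: Q].
  apply: (@sub_finite_set _ _ (q @` setT)); last exact: finite_image.
  move=> A _; exists (p A) => //.
  by apply: Qinj => /=; rewrite -pE.
have [f fD] := Ury.1 M Mfin; exists (f \o q) => s t /=; rewrite fD /=.
apply/eqP; rewrite eq_le; apply/andP; split.
  apply: le_trans (Dtri s _ _) _; rewrite Dsym pq add0r.
  by apply: le_trans (Dtri t _ _) _; rewrite pq addr0.
apply: le_trans (Dtri (p (q s)) _ _) _; rewrite pq add0r.
by apply: le_trans (Dtri (p (q t)) _ _) _; rewrite (Dsym (p (q t)) t) pq addr0.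
Qed.

(** The disjoint union of [X] and [Y] with cross distances [r] is a pseudometric space. After
    embedding it, homogeneity carries the copy of [Y] back onto [Y], and then [X] onto the resulting
    copy of [X]. *)
Lemma amalgam2 X Y (r : U -> U -> R) :
  (forall x y, x \in X -> y \in Y -> Sb S b (r x y)) ->
  (forall x x' y, x \in X -> x' \in X -> y \in Y ->
     r x y <= dist x x' + r x' y /\ dist x x' <= r x y + r x' y) ->
  (forall x y y', x \in X -> y \in Y -> y' \in Y ->
     r x y <= r x y' + dist y' y /\ dist y y' <= r x y + r x y') ->
  exists g, forall x y, x \in X -> y \in Y -> dist (g x) y = r x y.
Proof.
move=> rin rX rY.
pose x_ := tnth (in_tuple X); pose y_ := tnth (in_tuple Y).
have xX i : x_ i \in X by exact: mem_tnth.
have yY i : y_ i \in Y by exact: mem_tnth.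
pose D (s t : 'I_(size X) + 'I_(size Y)) : R := match s, t with
  | inl i, inl j => dist (x_ i) (x_ j)
  | inr i, inr j => dist (y_ i) (y_ j)
  | inl i, inr j | inr j, inl i => r (x_ i) (y_ j)
  end.
have [] := @pseudometric_embedding _ D.
- exact: finite_finset.
- by move=> [i|i] [j|j] /=; [exact: dist_in|exact: rin|exact: rin|exact: dist_in].
- by move=> [i|i] /=; exact: distxx.
- by move=> [i|i] [j|j] //=; exact: distC.
- move=> [i|i] [j|j] [k|k] /=; try exact: dist_tri.
  + by have [] := rX _ _ _ (xX j) (xX i) (yY k).
  + by have [+ _] := rX _ _ _ (xX k) (xX i) (yY j); rewrite distC addrC.
  + by have [_] := rY _ _ _ (xX i) (yY j) (yY k).
  + by have [_] := rX _ _ _ (xX j) (xX k) (yY i).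
  + by have [] := rY _ _ _ (xX j) (yY k) (yY i).
  + by have [+ _] := rY _ _ _ (xX k) (yY j) (yY i); rewrite distC addrC.
move=> e eD.
have [||g0 g0e] := @homogeneous _ (fun j => e (inr j)) y_.
- exact: finite_finset.
- by move=> i j; rewrite eD.
have [||g ge] := @homogeneous _ x_ (fun i => g0 (e (inl i))).
- exact: finite_finset.
- by move=> i j; rewrite isometry_dist eD.
exists g => x y /(@tnthP _ _ (in_tuple X))[i ->] /(@tnthP _ _ (in_tuple Y))[j ->].
by have := isometry_dist g0 (e (inl i)) (e (inr j)); rewrite g0e -ge eD.
Qed.

(** Amalgamation over [C]: apply [amalgam2] to [C ++ X] and [C ++ Y], keeping the true distance
    whenever one point is in [C]. Then every c in [C] gets distance 0 to its image and is fixed. *)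
Lemma amalgam C X Y (r : U -> U -> R) :
  (forall x y, x \in X -> y \in Y -> Sb S b (r x y)) ->
  (forall x y c, x \in X -> y \in Y -> c \in C ->
     [/\ r x y <= dist x c + dist c y, dist x c <= r x y + dist c y
       & dist c y <= r x y + dist x c]) ->
  (forall x x' y, x \in X -> x' \in X -> y \in Y ->
     r x y <= dist x x' + r x' y /\ dist x x' <= r x y + r x' y) ->
  (forall x y y', x \in X -> y \in Y -> y' \in Y ->
     r x y <= r x y' + dist y' y /\ dist y y' <= r x y + r x y') ->
  exists f, (forall c, c \in C -> f c = c) /\
    forall x y, x \in X -> y \in Y -> dist (f x) y = r x y.
Proof.
move=> rin rC rX rY.
pose r' x y := if (x \in C) || (y \in C) then dist x y else r x y.
have r'C x y c : x \in X -> y \in Y -> c \in C ->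
    [/\ r' x y <= dist x c + dist c y, dist x c <= r' x y + dist c y
      & dist c y <= r' x y + dist x c].
  move=> xX yY cC; rewrite /r'; case: ifP => _; last exact: rC.
  have := dist_tri c x y; have := dist_tri y x c; have := dist_tri x c y.
  by rewrite (distC y c) (distC c x) => *; split; lra.
have r'E x y : x \in C \/ y \in C -> r' x y = dist x y.
  by rewrite /r' => -[->|->]; rewrite ?orbT.
have catP A z : z \in C ++ A -> z \in C \/ z \notin C /\ z \in A.
  by rewrite mem_cat; case: (z \in C) => [|/= ->]; [left|right].
have r'X x x' y : x \in C ++ X -> x' \in C ++ X -> y \in C ++ Y ->
    r' x y <= dist x x' + r' x' y /\ dist x x' <= r' x y + r' x' y.
  have t1 := dist_tri x' x y; have t2 := dist_tri y x x'.
  rewrite (distC y) in t2.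
  move=> /catP[xC|[xC xX]] /catP[x'C|[x'C x'X]] /catP[yC|[yC yY]];
    try by rewrite !r'E; auto; lra.
  - by rewrite (r'E x); auto; have [] := r'C x' y x x'X yY xC; rewrite (distC x' x) => *; lra.
  - by rewrite (r'E x'); auto; have [] := r'C x y x' xX yY x'C => *; lra.
  - by rewrite /r' (negbTE xC) (negbTE x'C) (negbTE yC); exact: rX.
have r'Y x y y' : x \in C ++ X -> y \in C ++ Y -> y' \in C ++ Y ->
    r' x y <= r' x y' + dist y' y /\ dist y y' <= r' x y + r' x y'.
  have t1 := dist_tri y' x y; have t2 := dist_tri x y y'.
  rewrite (distC y x) in t2.
  move=> /catP[xC|[xC xX]] /catP[yC|[yC yY]] /catP[y'C|[y'C y'Y]];
    try by rewrite !r'E; auto; lra.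
  - by rewrite (r'E x y); auto; have [] := r'C x y' y xX y'Y yC; rewrite (distC y' y) => *; lra.
  - by rewrite (r'E x y'); auto; have [] := r'C x y y' xX yY y'C; rewrite (distC y y') => *; lra.
  - by rewrite /r' (negbTE xC) (negbTE yC) (negbTE y'C); exact: rY.
have [|//|//|f fr] := @amalgam2 (C ++ X) (C ++ Y) r'.
  move=> x y /catP[xC|[xC xX]] /catP[yC|[yC yY]];
    try by rewrite r'E; auto; exact: dist_in.
  by rewrite /r' (negbTE xC) (negbTE yC); exact: rin.
exists f; split=> [c cC|x y xX yY].
  by apply/dist_eq0; rewrite fr ?mem_cat ?cC // r'E; auto; exact: distxx.
(* When x or y lies in [C], the inequalities [rC] at that very point force r x y to be the true
   distance. *)
rewrite fr ?mem_cat ?xX ?yY ?orbT // /r'; case: ifP => // /orP[cC|cC].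
  by have [r1 _ r2] := rC x y x xX yY cC; rewrite distxx in r1 r2; lra.
by have [r1 r2 _] := rC x y y xX yY cC; rewrite distxx in r1 r2; lra.
Qed.

End Amalgamation.

(** * Arithmetic of the distance set *)

Record dense_scale (R : realType) (S : set R) (b : \bar R) : Prop := DenseScale {
  dense_scale_zmod : zmod_closed (mem S);
  dense_scale_dense : dense S;
  dense_scale_top : (exists2 b0 : R, S b0 /\ 0 < b0 & b = b0%:E) \/ b = +oo%E
}.

Lemma filter_seq (T : Type) (F : set_system T) (I : eqType) (s : seq I)
    (P : I -> T -> Prop) : Filter F ->
  (forall i, i \in s -> F (P i)) -> F [set t | forall i, i \in s -> P i t].
Proof.
move=> FF; elim: s => [|i s IH] Ps; first by apply: filterS filterT.
have Pi := Ps i (mem_head _ _).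
have {}IH : F [set t | forall i, i \in s -> P i t].
  by apply: IH => j js; apply: Ps; rewrite inE js orbT.
by apply: filterS (filterI Pi IH) => t [it st] j /predU1P[->|/st].
Qed.

Section DenseScale.
Context {R : realType} {S : set R} {b : \bar R} (hS : dense_scale S b).

Lemma scaleB x y : S x -> S y -> S (x - y).
Proof.
have [_ SB] := dense_scale_zmod hS.
by move=> /mem_set xS /mem_set yS; apply: set_mem; exact: SB.
Qed.

Lemma scaleD x y : S x -> S y -> S (x + y).
Proof.
have [S0 _] := dense_scale_zmod hS => xS yS; rewrite -(opprK y) -(sub0r y).
by apply/scaleB/scaleB => //; exact: set_mem.
Qed.

Lemma scaleMn x n : S x -> S (x *+ n).
Proof.
move=> xS; elim: n => [|n IH]; first by rewrite mulr0n -(subrr x); exact: scaleB.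
by rewrite mulrS; exact: scaleD.
Qed.

Lemma scale_between x y : x < y -> exists s, S s /\ x < s < y.
Proof.
move=> xy; have xyO : open [set` `]x, y[] by exact: interval_open.
have [|s [sxy Ss]] := dense_scale_dense hS _ xyO.
  by exists ((x + y) / 2) => /=; rewrite in_itv /=; apply/andP; split; lra.
by exists s; split=> //; move: sxy => /=; rewrite in_itv.
Qed.

(** [M] stands in for the largest distance: it is b when b is finite, and an element of S beyond [K]
    otherwise. *)
Lemma scale_cap (K : R) : exists M, [/\ Sb S b M, 0 < M,
  forall r, (r%:E <= b)%E -> r <= K -> r <= M &
  forall r, (r%:E < b)%E -> r <= K -> r < M].
Proof.
have [[b0 [Sb0 b0gt0] ->]|->] := dense_scale_top hS.
  by exists b0; split=> //; split=> //=; rewrite !lee_fin ltW /=.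
have [|M [SM /andP[M1 M2]]] := @scale_between (`|K| + 1) (`|K| + 2); first lra.
have KK := ler_norm K; have K0 := normr_ge0 K.
exists M; split=> [||r _ ?|r _ ?]; [|lra|lra|lra].
by split=> //=; rewrite lee_fin leey andbT; lra.
Qed.



Lemma near_lt (x : R) : \forall e \near 0^'+, 0 < x -> e < x.
Proof.
have [x0|x0] := ltP 0 x; last by near=> e.
by near=> e => _; near: e; exact: nbhs_right_lt.
Unshelve. all: by end_near. Qed.

(** Makes finitely many strict inequalities about triples of points stable under a common small
    perturbation. *)
Lemma near_lt_seq3 (I : eqType) (s : seq I) (f : I -> I -> I -> R) :
  \forall e \near 0^'+, forall i j k, i \in s -> j \in s -> k \in s ->
    0 < f i j k -> e < f i j k.
Proof.
have : \forall e \near 0^'+, forall i, i \in s -> forall j, j \in s ->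
    forall k, k \in s -> 0 < f i j k -> e < f i j k.
  apply: filter_seq => i _; apply: filter_seq => j _; apply: filter_seq => k _.
  exact: near_lt.
by apply: filterS => e fe i j k si sj sk; exact: fe.
Qed.

Lemma scale_near (P : R -> Prop) : (\forall e \near 0^'+, P e) ->
  exists e, [/\ Sb S b e, 0 < e & P e].
Proof.
move=> [d /= d0 dP]; have [M [[_ /andP[_ Mb]] M0 _ _]] := scale_cap 0.
have [|s [Ss /andP[s0]]] := @scale_between 0 (Num.min d M).
  by rewrite lt_min d0.
rewrite lt_min => /andP[sd sM].
exists s; split=> //; last by apply: dP => //=; rewrite sub0r normrN gtr0_norm.
by split=> //=; rewrite lee_fin ltW //=; apply: le_trans Mb; rewrite lee_fin ltW.
Qed.

Lemma near_addb (r : R) : (r%:E < b)%E -> \forall e \near 0^'+, ((e + r)%:E < b)%E.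
Proof.
case: b hS => [b0||] h //; last by move=> _; near=> e; rewrite ltry.
rewrite lte_fin -subr_gt0 => rb; near=> e; rewrite lte_fin -ltrBrDr.
by near: e; exact: nbhs_right_lt.
Unshelve. all: by end_near. Qed.

Lemma Sb_lower r s : Sb S b r -> S s -> 0 <= s -> s <= r -> Sb S b s.
Proof.
move=> [_ /andP[_ rb]] Ss s0 sr; split=> //; rewrite lee_fin s0 /=.
by apply: le_trans rb; rewrite lee_fin.
Qed.

End DenseScale.

(** * Free amalgams, double cosets and prescribed extensions *)

Section Extensions.
Context {R : realType} {S : set R} {b : \bar R} (U : metricSpace S b).
Context (hS : dense_scale S b) (Ury : urysohn U).
Implicit Types (x y z u v : U) (f g h k : Isom U) (A C X Y : seq U) (M K : R).

Definition fixes A g := forall x, x \in A -> g x = x.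

(** The distance of x and y in the free amalgam over [C]: the shortest path through [C], capped at
    [M]. *)
Definition hop M C x y : R :=
  foldr (fun c m => Num.min m (dist x c + dist c y)) M C.

Lemma hop_leM M C x y : hop M C x y <= M.
Proof. by elim: C => //= c C IH; rewrite ge_min IH. Qed.

Lemma hop_le M C x y c : c \in C -> hop M C x y <= dist x c + dist c y.
Proof.
elim: C => //= c' C IH; rewrite inE ge_min => /predU1P[->|/IH ->//].
by rewrite lexx orbT.
Qed.

Lemma hop_cases M C x y : hop M C x y = M \/
  exists2 c, c \in C & hop M C x y = dist x c + dist c y.
Proof.
elim: C => [|c C IH] /=; first by left.
rewrite minEle; case: ifP => _; last by right; exists c; rewrite ?mem_head.
by case: IH => [|[c' c'C]]; [left|right; exists c' => //; rewrite inE c'C orbT].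
Qed.

Lemma hopC M C x y : hop M C x y = hop M C y x.
Proof. by elim: C => //= c C ->; rewrite (distC x c) (distC c y) addrC. Qed.

Lemma hop_gt (l : R) M C x y : l < M ->
  (forall c, c \in C -> l < dist x c + dist c y) -> l < hop M C x y.
Proof. by move=> lM lC; have [->|[c cC ->]] := hop_cases M C x y; last exact: lC. Qed.

Lemma hop_ge (l : R) M C x y : l <= M ->
  (forall c, c \in C -> l <= dist x c + dist c y) -> l <= hop M C x y.
Proof. by move=> lM lC; have [->|[c cC ->]] := hop_cases M C x y; last exact: lC. Qed.

Lemma hop_in M C x y : Sb S b M -> Sb S b (hop M C x y).
Proof.
move=> Mb; apply: (Sb_lower Mb); last exact: hop_leM.
  have [->|[c _ ->]] := hop_cases M C x y; first by have [] := Mb.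
  by apply: (scaleD hS); exact: (dist_in _ _).1.
apply: hop_ge => [|c _]; first by have [_ /andP[]] := Mb.
by rewrite addr_ge0 // dist_ge0.
Qed.

Lemma hop_ler M C x x' y : hop M C x y <= dist x x' + hop M C x' y.
Proof.
have := dist_ge0 x x'; have [->|[c cC ->]] := hop_cases M C x' y.
  by have := hop_leM M C x y; lra.
by have := hop_le M x y cC; have := dist_tri x' x c; lra.
Qed.

Lemma hop_tri M C x x' y : dist x x' <= M ->
  dist x x' <= hop M C x y + hop M C x' y.
Proof.
have hop0 z : 0 <= dist x x' -> dist x x' <= M -> 0 <= hop M C z y.
  move=> ? ?; apply: hop_ge => [|c _]; first lra.
  by rewrite addr_ge0 // dist_ge0.
move=> xM; have x0 := dist_ge0 x x'; have := hop0 x x0 xM; have := hop0 x' x0 xM.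
have [->|[c cC ->]] := hop_cases M C x y; first lra.
have [->|[c' c'C ->]] := hop_cases M C x' y; first lra.
have := dist_tri c x x'; have := dist_tri y c x'; have := dist_tri c' y x'.
by rewrite (distC y c') (distC c' x') => *; lra.
Qed.

Lemma dist_bounded A : exists K, forall x y, x \in A -> y \in A -> dist x y <= K.
Proof.
exists (\sum_(x <- A) \sum_(y <- A) dist x y) => x y xA yA.
have sum_ge (f : U -> R) z : (forall z, 0 <= f z) -> z \in A ->
    f z <= \sum_(z <- A) f z.
  by move=> f0 zA; rewrite (big_rem z) //= lerDl sumr_ge0.
apply: (le_trans _ (sum_ge (fun x => \sum_(y <- A) dist x y) x _ xA)).
  by apply: (sum_ge (dist x)) => // z; exact: dist_ge0.
by move=> z; apply: sumr_ge0 => *; exact: dist_ge0.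
Qed.

Lemma dist_cap A K : exists M, [/\ Sb S b M, 0 < M,
  forall r, (r%:E <= b)%E -> r <= K -> r <= M,
  forall r, (r%:E < b)%E -> r <= K -> r < M &
  forall x y, x \in A -> y \in A -> dist x y <= M].
Proof.
have [K' AK'] := dist_bounded A.
have [M [Mb M0 leM ltM]] := scale_cap hS (Num.max K K').
exists M; split=> // [r rb rK|r rb rK|x y xA yA].
- by apply: leM => //; rewrite le_max rK.
- by apply: ltM => //; rewrite le_max rK.
- by apply: leM; rewrite ?dist_le_b // le_max AK' ?orbT.
Qed.

(** The stabilizer of [C] can move [X] as far from [Y] as the distances to [C] allow. The bound [K]
    is at the caller's disposal, to make the cap exceed the distances of interest. *)
Lemma free_amalgam C X Y K : exists M f, [/\
  [/\ Sb S b M, 0 < M, forall r, (r%:E <= b)%E -> r <= K -> r <= M &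
    forall r, (r%:E < b)%E -> r <= K -> r < M],
  fixes C f & forall x y, x \in X -> y \in Y -> dist (f x) y = hop M C x y].
Proof.
have [M [Mb M0 leM ltM AM]] := dist_cap (C ++ X ++ Y) K.
have {}AM x y : (x \in C) || (x \in X) || (x \in Y) ->
    (y \in C) || (y \in X) || (y \in Y) -> dist x y <= M.
  by move=> xA yA; apply: AM; rewrite !mem_cat orbA.
suff [f [fC fXY]] : exists f, (forall c, c \in C -> f c = c) /\
    forall x y, x \in X -> y \in Y -> dist (f x) y = hop M C x y by exists M, f.
apply: (amalgam Ury) => [x y _ _|x y c xX yY cC|x x' y xX x'X _|x y y' _ yY y'Y].
- exact: hop_in.
- split; first exact: hop_le.
    have [->|[c' c'C ->]] := hop_cases M C x y.
      have := AM x c; rewrite xX cC !orbT => /(_ isT isT).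
      by have := dist_ge0 c y; lra.
    have := dist_tri c' x c; have := dist_tri y c' c; rewrite (distC y c); lra.
  have [->|[c' c'C ->]] := hop_cases M C x y.
    have := AM c y; rewrite yY cC !orbT => /(_ isT isT).
    by have := dist_ge0 x c; lra.
  have := dist_tri x c y; have := dist_tri c' x y; rewrite (distC c x); lra.
- by split; [exact: hop_ler|apply: hop_tri; apply: AM; rewrite ?xX ?x'X !orbT].
- rewrite !(hopC _ _ x); split; last by apply: hop_tri; apply: AM; rewrite ?yY ?y'Y !orbT.
  by rewrite addrC distC; exact: hop_ler.
Qed.

(** The double coset of g modulo the stabilizer of [A] is determined by the position of g A relative
    to A. The cross distances [r] put h y and g y at distance 0, so some s fixing [A] has s h = g on
    [A]. *)
Lemma double_coset A g h :
  (forall x y, x \in A -> y \in A -> dist x (g y) = dist x (h y)) ->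
  exists s t, [/\ fixes A s, fixes A t & g = (s * h * t)%g].
Proof.
move=> gh; pose r x y := dist x (h ((g^-1 : Isom U)%g y)).
have [||||s [sA sr]] := @amalgam _ _ _ U Ury A (map h A) (map g A) r.
- by move=> *; exact: dist_in.
- move=> x _ c _ /mapP[y yA ->] cA; rewrite /r isometry_mulVK gh //.
  have := dist_tri c x (h y); have := dist_tri (h y) x c.
  have := dist_tri x c (h y); rewrite (distC (h y) c) (distC c x) => *.
  by split; lra.
- move=> x x' y _ _ _; rewrite /r; split; first exact: dist_tri.
  by rewrite (distC x'); exact: dist_tri.
- move=> x y y' _ _ _; rewrite /r.
  rewrite -(isometry_dist (g^-1)%g y') -(isometry_dist (g^-1)%g y).
  rewrite -(isometry_dist h _ ((g^-1)%g y)) -(isometry_dist h _ ((g^-1)%g y')).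
  by split; [exact: dist_tri|rewrite (distC x); exact: dist_tri].
exists s, ((s * h)^-1 * g)%g; split=> //; last by rewrite mulVKg.
move=> x xA; have -> : ((s * h)^-1 * g)%g x = ((s * h)^-1)%g (g x) by [].
rewrite -[RHS](isometry_mulVK (s * h)%g); congr (isometry_fun (s * h)^-1%g _).
apply/esym/dist_eq0.
have -> : (s * h)%g x = s (h x) by [].
by rewrite sr ?map_f // /r isometry_mulVK distxx.
Qed.

(* The five-fold product is [u * v^-1] where [u] and [v] lie in the double     *)
(* coset of [h] and [u] is chosen so that [u A] is positioned over [k A] as it *)
(* is over [A].                                                                *)
Lemma five_fold_product A h k :
  (forall x y z, x \in A -> y \in A -> z \in A ->
     dist x (k y) <= dist x (h z) + dist y (h z) /\
     `|dist x (h z) - dist y (h z)| <= dist x (k y)) ->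
  exists s t u : Isom U, [/\ fixes A s, fixes A t, fixes A u & k = (s * h * t * h^-1 * u)%g].
Proof.
move=> hk; pose r x y := dist x ((k^-1 : Isom U)%g y).
have [||||f [fA fr]] := @amalgam _ _ _ U Ury A (map h A) (map k A) r.
- by move=> *; exact: dist_in.
- move=> _ _ c /mapP[x xA ->] /mapP[y yA ->] cA; rewrite /r isometry_mulVK.
  have [k1] := hk c y x cA yA xA; rewrite ler_norml => /andP[k2 k3].
  by rewrite !(distC (h x)); split; lra.
- move=> x x' y _ _ _; rewrite /r; split; first exact: dist_tri.
  by rewrite (distC x'); exact: dist_tri.
- move=> x y y' _ _ _; rewrite /r.
  rewrite -(isometry_dist (k^-1)%g y') -(isometry_dist (k^-1)%g y).
  by split; [exact: dist_tri|rewrite (distC x); exact: dist_tri].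
have [x y xA yA|s [t [sA tA e]]] := @double_coset A (k^-1 * (f * h))%g h.
  have -> : (k^-1 * (f * h))%g y = (k^-1)%g (f (h y)) by [].
  rewrite distC dist_isometry_inv fr ?map_f // /r isometry_mulVK distC.
  by [].
exists f, (t^-1)%g, (s^-1)%g; split=> //.
- by move=> x /tA {1}<-; rewrite isometry_mulVK.
- by move=> x /sA {1}<-; rewrite isometry_mulVK.
- have -> : k = (f * h * (k^-1 * (f * h))^-1)%g.
    by rewrite invgM invgK mulVKg.
  by rewrite e !invgM !mulgA.
Qed.

Lemma urysohn_inhabited : exists u : U, True.
Proof.
have [M [Mb M0 _ _]] := scale_cap hS 0.
have S0 : Sb S b 0.
  apply: (Sb_lower Mb) => //; last exact: ltW.
  by rewrite -(subrr M); apply: (scaleB hS); have [] := Mb.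
have [|//|//|//|*|f _] := @pseudometric_embedding _ _ _ U Ury unit (fun _ _ => 0).
- exact: finite_finset.
- by rewrite addr0.
- by exists (f tt).
Qed.

(** The hypotheses make [p] a Katetov function on [X]. The auxiliary point w is a one-point space to
    be amalgamated with [X]. *)
Lemma one_point_extension X (p : U -> R) :
  (forall x, x \in X -> Sb S b (p x)) ->
  (forall x y, x \in X -> y \in X ->
    p x <= p y + dist y x /\ dist x y <= p x + p y) ->
  exists v, forall x, x \in X -> dist v x = p x.
Proof.
move=> pin pX; have [w _] := urysohn_inhabited.
have [|||f fp] := @amalgam2 _ _ _ U Ury [:: w] X (fun _ => p).
- by move=> _ x _; exact: pin.
- move=> x x' y; rewrite !inE => -> -> yX; rewrite distxx add0r.
  by split=> //; have [_ /andP[]] := pin _ yX; rewrite lee_fin => ? _; lra.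
- by move=> _ x y _; exact: pX.
by exists (f w) => x xX; apply: fp => //; rewrite mem_head.
Qed.

Lemma pair_homogeneous u v u' v' : dist u v = dist u' v' ->
  exists g, g u = u' /\ g v = v'.
Proof.
move=> e; have [||g gE] := @homogeneous _ _ _ U Ury bool
  (fun i => if i then u else v) (fun i => if i then u' else v').
- exact: finite_finset.
- by move=> [] []; rewrite ?distxx // distC -e distC.
- by exists g; split; [exact: (gE true)|exact: (gE false)].
Qed.

(** Amalgamates [A] with a copy of itself. The Lipschitz condition on [p] and p t >= t on the
    distances of [A] supply the two kinds of triangle inequalities. *)
Lemma shift_isometry A (p : R -> R) :
  (forall x y, x \in A -> y \in A -> Sb S b (p (dist x y))) ->
  (forall s t t', 0 <= t' -> s <= t' + t -> p s <= t' + p t) ->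
  (forall x y, x \in A -> y \in A -> dist x y <= p (dist x y)) ->
  exists g, forall x y, x \in A -> y \in A -> dist (g x) y = p (dist x y).
Proof.
move=> pin plip pge.
apply: (@amalgam2 _ _ _ U Ury A A (fun x y => p (dist x y))) => //.
- move=> x x' y xA x'A yA; split; first by apply: plip; [exact: dist_ge0|exact: dist_tri].
  have := pge _ _ xA yA; have := pge _ _ x'A yA; have := dist_tri y x x'.
  by rewrite (distC y x') => *; lra.
- move=> x y y' xA yA y'A; split.
    by rewrite addrC; apply: plip; [exact: dist_ge0|rewrite addrC; exact: dist_tri].
  have := pge _ _ xA yA; have := pge _ _ xA y'A; have := dist_tri x y y'.
  by rewrite (distC y x) => *; lra.
Qed.

End Extensions.

(** * Coarse group topologies *)

Section CoarseFilters.
Context {R : realType} {S : set R} {b : \bar R} (U : metricSpace S b).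
Context (hS : dense_scale S b) (Ury : urysohn U).
Context (F : set_system (Isom U)) (gF : group_filter F).
Context (Fst : forall V, F V -> exists A : seq U, forall g, fixes A g -> V g).
Implicit Types (x y z u v a c : U) (f g h k : Isom U) (A C : seq U).
Implicit Types (V W : set (Isom U)).

Local Instance Ffilter : Filter F := group_filter_filter gF.

(** By [five_fold_product], k is a product of elements h, h^-1 and stabilizer elements, all in a
    neighbourhood small enough for such products to stay in [W]. *)
Lemma coarse_double_coset W : F W -> exists V A, [/\ F V,
  forall g, fixes A g -> V g & forall h k, V h ->
    (forall x y z, x \in A -> y \in A -> z \in A ->
       dist x (k y) <= dist x (h z) + dist y (h z) /\
       `|dist x (h z) - dist y (h z)| <= dist x (k y)) -> W k].
Proof.
move=> /(group_filterM3 gF)[V1 [/(group_filterM3 gF)[V2 [FV2 V2V V21]] _ V1W]].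
have V2_1 : V2 1%g by exact: (group_filter1 gF).
have V2V1 g : V2 g -> V1 g by move=> V2g; have := V21 _ _ _ V2_1 V2_1 V2g; rewrite !mul1g.
have [A AV] := Fst FV2; exists V2, A; split=> // h k Vh.
move=> /(five_fold_product Ury)[s [t [u [sA tA uA ->]]]]; apply: V1W.
- by apply: V21 => //; exact: AV.
- exact/V2V1/V2V.
- exact/V2V1/AV.
Qed.

(** The tool for improving a position: distances between [h^-1 * f * h] applied to x and a point y
    are those between f (h x) and h y, and f can be chosen by amalgamation. *)
Lemma coarse_conj W : F W -> exists V A, F V /\
  forall h f, V h -> fixes A f -> W (h^-1 * f * h)%g.
Proof.
move=> /(group_filterM3 gF)[V [FV VV VW]]; have [A AV] := Fst FV.
by exists V, A; split=> // h f Vh fA; apply: VW => //; [exact: VV|exact: AV].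
Qed.

(** Passes from one point to a finite set by induction: h places the old points, g places the new
    point a, and f in between restores the position of the old points, which g may have spoilt. *)
Lemma coarse_propagation (P : U -> U -> seq U -> Prop) :
  (forall V C a, F V -> a \in C -> exists2 V', F V' & forall h, V' h ->
     exists2 g, V g & forall f, fixes C f -> P a (g (f (h a))) C) ->
  (forall C C', {subset C <= C'} -> exists2 V, F V & forall g h A, V g -> V h ->
     (forall a, a \in A -> P a (h a) C') ->
     exists2 f, fixes C' f & forall a, a \in A -> P a (g (f (h a))) C) ->
  (forall a x C C', {subset C <= C'} -> P a x C' -> P a x C) ->
  forall V A C, F V -> exists2 h, V h & forall a, a \in A -> P a (h a) C.
Proof.
move=> Ppoint Pext Psub V A C; elim: A V C => [|a A IH] V C FV.
  by exists 1%g => //; exact: (group_filter1 gF).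
have [V1 [FV1 _ V1V]] := group_filterM3 gF FV; have [B BV1] := Fst FV1.
(* Fixing [B] keeps f in the neighbourhood [V1]; fixing a and [C] lets the choice of g survive any
   such f. *)
pose C' := a :: C ++ B.
have CC' : {subset C <= C'} by move=> x xC; rewrite inE mem_cat xC orbT.
have [V0 FV0 V0P] := Pext _ _ CC'.
have [V2 FV2 V2P] := Ppoint _ C' a (filterI FV1 FV0) (mem_head _ _).
have [h [V1h [V2h V0h]] hP] := IH _ C' (filterI FV1 (filterI FV2 FV0)).
have [g [V1g V0g] gP] := V2P _ V2h.
have [f fC' fP] := V0P _ _ _ V0g V0h hP.
exists (g * f * h)%g.
  apply: V1V => //; apply: BV1 => x xB; apply: fC'.
  by rewrite inE mem_cat xB !orbT.
move=> x /predU1P[->|xA]; last exact: fP.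
by apply: Psub CC' _; exact: gP.
Qed.

Lemma coarse_pair_homogeneous (P : R -> Prop) u v u' v' : dist u v = dist u' v' ->
  F [set g | P (dist (g u) v)] -> F [set g | P (dist (g u') v')].
Proof.
move=> /esym/(pair_homogeneous Ury)[k [ku kv]] /(group_filterJ gF k).
apply: filterS => g Pg; have : P (dist (k (g ((k^-1)%g u))) v) := Pg.
by rewrite -ku -kv isometry_mulVK isometry_dist.
Qed.

(** * Filters missing a set of small moves *)

Section Far.
Context (d : R) (d_ge0 : 0 <= d) (d_ltb : ((4 * d)%:E < b)%E).
Context (u0 : U) (u0F : ~ F [set g | dist (g u0) u0 <= 6 * d]).

(* If all of [V a] lies near the finite set [C], then intersecting [V] with its *)
(* conjugate by some [s] fixing [a] and moving [C] freely over [a] leaves only  *)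
(* the points of [V a] near [a].                                                *)
Lemma far_point V C a : F V -> exists2 g, V g & forall c, c \in C -> 2 * d < dist (g a) c.
Proof.
move=> FV; apply: contrapT => Vfar; apply: u0F.
have {Vfar} Vnear g : V g -> exists2 c, c \in C & dist (g a) c <= 2 * d.
  move=> Vg; apply: contrapT => gfar; apply: Vfar; exists g => // c cC.
  by rewrite ltNge; apply/negP => gc; apply: gfar; exists c.
have [M [s [[_ _ _ ltM] sa sC]]] := free_amalgam hS Ury [:: a] C C (4 * d).
have {}sa : s a = a by apply: sa; exact: mem_head.
apply: (@coarse_pair_homogeneous (fun r => r <= 6 * d) a a); rewrite ?distxx //.
apply: filterS (filterI FV (group_filterJ gF (s^-1)%g FV)) => g [Vg /= Vsg].
have [c cC gc] := Vnear _ Vg; have [c' c'C gc'] := Vnear _ Vsg.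
have {}gc' : dist ((s^-1)%g (g (s a))) c' <= 2 * d by move: gc'; rewrite invgK.
rewrite sa dist_isometry_inv in gc'.
have := sC _ _ c'C cC; have := dist_tri (g a) (s c') c; rewrite (distC (s c') (g a)).
have := dist_tri c (g a) a; rewrite (distC c a).
(* Since g a is within 2 d of both c and s c', these are at most 4 d < M apart. Their shortest path
   therefore passes through a, so d(c, a) <= 4 d and g a is within 6 d of a. *)
have [->|[c'' /[!inE] -> ->]] := hop_cases M [:: a] c' c.
  by have := ltM _ d_ltb (lexx _); lra.
by have := dist_ge0 c' a; lra.
Qed.

Lemma far_all V A C : F V ->
  exists2 h, V h & forall a, a \in A -> forall c, c \in C -> d < dist (h a) c.
Proof.
apply: (@coarse_propagation (fun _ x C => forall c, c \in C -> d < dist x c)).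
- move=> {}V {}C a FV aC; exists setT; first exact: filterT.
  move=> h _; have [hfar|hnear] := pselect (forall c, c \in C -> d < dist (h a) c).
    exists 1%g => [|f fC c cC]; first exact: (group_filter1 gF).
    by change (d < dist (f (h a)) c); rewrite -(fC _ cC) isometry_dist hfar.
  (* If h a is within d of c0, it suffices to move c0 more than 2 d away from [C]; f fixes c0 and so
     preserves this closeness. *)
  have [c0 c0C hc0] : exists2 c, c \in C & dist (h a) c <= d.
    apply: contrapT => hn; apply: hnear => c cC.
    by rewrite ltNge; apply/negP => hc; apply: hn; exists c.
  have [g Vg gC] := far_point C c0 FV; exists g => // f fC c cC.
  have := gC _ cC; have := dist_tri (g (f (h a))) (g c0) c.
  rewrite isometry_dist -{2}(fC _ c0C) isometry_dist (distC c0); lra.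
- move=> {}C C' CC'; exists setT; first exact: filterT.
  move=> g h {}A _ _ hA.
  have [M [f [[_ M0 _ ltM] fC' fA]]] :=
    free_amalgam hS Ury C' (map h A) (map (g^-1)%g C) d.
  exists f => // a aA c cC; rewrite distC -dist_isometry_inv distC.
  rewrite fA ?map_f //; apply: hop_gt => [|c' c'C'].
    by apply: ltM => //; apply: le_lt_trans d_ltb; rewrite lee_fin; have := d_ge0; lra.
  by have := hA _ aA _ c'C'; have := dist_ge0 c' ((g^-1)%g c); lra.
- by move=> _ x {}C C' CC' C'P c /CC'; exact: C'P.
Qed.

End Far.

Definition spreads (s : R) := forall V A, F V -> exists2 h, V h &
  forall x y, x \in A -> y \in A -> s <= dist (h x) y.

(** If h A is at distance at least s from the fixed points, paths through them have length at least
    2 s. An amalgam over them can thus separate h A from its image by r <= 2 s, and conjugating by h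
    transfers this to A. *)
Lemma spread_exact (s r : R) : spreads s -> Sb S b r -> r <= 2 * s ->
  forall V A, F V -> exists2 h, V h &
  forall x y, x \in A -> y \in A -> dist (h x) y = Num.max (dist x y) r.
Proof.
move=> sp rb rs V A /coarse_conj[V1 [B [FV1 V1V]]].
have [h V1h hs] := sp V1 (B ++ A) FV1.
have hsA x y : x \in A -> y \in B ++ A -> s <= dist (h x) y.
  by move=> xA yA; apply: hs => //; rewrite mem_cat xA orbT.
have le_maxl (x y : R) : x <= Num.max x y by rewrite le_max lexx.
have [||||f [fB fA]] := @amalgam _ _ _ U Ury (B ++ A) (map h A) (map h A)
  (fun x y => Num.max (dist x y) r).
- by move=> x y _ _; rewrite /Num.max; case: ifP => // _; exact: dist_in.
- move=> _ _ c /mapP[x xA ->] /mapP[y yA ->] cA.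
  have r1 := hsA _ _ xA cA; have r2 := hsA _ _ yA cA.
  have := le_maxl (dist (h x) (h y)) r; have := dist_tri (h y) (h x) c.
  have := dist_tri (h x) c (h y); have := dist_tri c (h x) (h y).
  rewrite ge_max (distC (h y) c) in r2 *; rewrite (distC c (h x)) => *.
  by split; [apply/andP; split|..]; lra.
- move=> x x' y _ _ _; have := le_maxl (dist x y) r; have := le_maxl (dist x' y) r.
  have r1 : r <= Num.max (dist x' y) r by rewrite le_max lexx orbT.
  have := dist_tri x' x y; have := dist_tri y x x'; have := dist_ge0 x x'.
  rewrite (distC y) ge_max => *; split; last lra.
  by apply/andP; split; lra.
- move=> x y y' _ _ _; have := le_maxl (dist x y) r; have := le_maxl (dist x y') r.
  have r1 : r <= Num.max (dist x y') r by rewrite le_max lexx orbT.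
  have := dist_tri y' x y; have := dist_tri x y y'; have := dist_ge0 y' y.
  rewrite (distC y x) ge_max => *; split; last lra.
  by apply/andP; split; lra.
exists (h^-1 * f * h)%g.
  by apply: V1V => // x xB; apply: fB; rewrite mem_cat xB.
move=> x y xA yA; have -> : (h^-1 * f * h)%g x = (h^-1)%g (f (h x)) by [].
by rewrite dist_isometry_inv fA ?map_f // isometry_dist.
Qed.

Lemma coarse_trivial u (e : R) : 0 < e -> (e%:E <= b)%E ->
  ~ F [set g | dist (g u) u <= e] -> forall W, F W -> W = setT.
Proof.
move=> e0 eb uF; pose d := e / 6.
have d0 : 0 < d by rewrite /d; lra.
have db : ((4 * d)%:E < b)%E by apply: lt_le_trans eb; rewrite lte_fin /d; lra.
have uF' : ~ F [set g | dist (g u) u <= 6 * d].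
  by have -> : 6 * d = e by rewrite /d; lra.
have spd : spreads d.
  move=> V A FV; have [h Vh hA] := far_all (ltW d0) db uF' A A FV.
  by exists h => // x y xA yA; exact/ltW/hA.
have spn n r : Sb S b r -> r < d * n.+1%:R -> spreads r.
  elim: n r => [|n IH] r rb rd V A FV.
    have [h Vh hA] := spd V A FV; exists h => // x y xA yA.
    by have := hA _ _ xA yA; rewrite mulr1 in rd; lra.
  have [r0|r0] := leP r 0.
    exists 1%g => [|x y _ _]; first exact: (group_filter1 gF).
    exact: le_trans r0 (dist_ge0 _ _).
  have dn : d * n.+2%:R <= 2 * (d * n.+1%:R).
    have n1 : 1 <= n.+1%:R :> R by rewrite ler1n.
    have : d * 1 <= d * n.+1%:R by rewrite ler_pM2l.
    by rewrite -(natr1 n.+1) mulrDr; lra.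
  (* An intermediate s in S, already reached by induction, whose double exceeds r. *)
  have [|s [Ss /andP[rs]]] := @scale_between _ _ _ hS (r / 2) (Num.min r (d * n.+1%:R)).
    by rewrite lt_min; apply/andP; split; lra.
  rewrite lt_min => /andP[sr sd].
  have sb : Sb S b s by apply: (Sb_lower rb) => //; lra.
  have [|h Vh hA] := spread_exact (IH s sb sd) rb _ A FV; first lra.
  by exists h => // x y xA yA; rewrite hA // le_max lexx orbT.
move=> W /coarse_double_coset[V [A [FV AV VW]]].
apply/seteqP; split=> // k _.
have [M [Mb M0 _ _ AM]] := dist_cap hS (A ++ map k A) 0.
have spM : spreads M.
  apply: (spn (Num.bound (M / d))) => //.
  rewrite mulrC -ltr_pdivrMr // -natr1; have := @archi_boundP _ (M / d).
  by rewrite divr_ge0 ?ltW // => /(_ isT); lra.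
have [|h Vh hA] := spread_exact spM Mb _ A FV; first lra.
(* With all these distances equal to [M], the conditions on k become 0 <= d(x, k y) <= 2 M, which
   holds by the choice of [M]. *)
have hM x y : x \in A -> y \in A -> dist x (h y) = M.
  move=> xA yA; rewrite distC hA //; apply/max_idPr.
  by apply: AM; rewrite mem_cat ?xA ?yA.
apply: (VW h) => // x y z xA yA zA; rewrite !hM // subrr normr0 dist_ge0; split=> //.
by apply: (@le_trans _ _ M); [apply: AM; rewrite mem_cat ?xA ?map_f ?orbT|lra].
Qed.

(** [far_all] with d = 0 makes h A disjoint from A. The conditions on k are then triangle
    inequalities when d(x, y) is positive, below b and kept by k. For x = y, and for d(x, y) = b
    where two distances in (0, b] differ by less than b, there is room for an error e. *)
Lemma coarse_not_stabilizer u : ~ F [set g | g u = u] -> forall W, F W ->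
  exists A (e : R), [/\ Sb S b e, 0 < e & forall k,
    (forall x, x \in A -> dist (k x) x <= e) ->
    (forall x y, x \in A -> y \in A -> 0 < dist x y -> ((dist x y)%:E < b)%E ->
       dist (k x) y = dist x y) -> W k].
Proof.
move=> uF W /coarse_double_coset[V [A [FV AV VW]]].
have b0 : ((4 * (0 : R))%:E < b)%E.
  rewrite mulr0; have [M [[_ /andP[_ Mb]] M0 _ _]] := scale_cap hS 0.
  by apply: lt_le_trans Mb; rewrite lte_fin.
have uF' : ~ F [set g | dist (g u) u <= 6 * 0].
  move=> Fu; apply: uF; apply: filterS Fu => g /=; rewrite mulr0 => gu.
  by apply/dist_eq0/eqP; rewrite eq_le gu dist_ge0.
have [h Vh hA] := far_all (lexx 0) b0 uF' A A FV.
have [e [eb e0 [eA eA']]] : exists e, [/\ Sb S b e, 0 < e &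
    (forall x y z, x \in A -> y \in A -> z \in A ->
      0 < dist (h x) y -> e < dist (h x) y) /\
    (forall x y z, x \in A -> y \in A -> z \in A ->
      0 < dist x y - `|dist x (h z) - dist y (h z)| ->
      e < dist x y - `|dist x (h z) - dist y (h z)|)].
  apply: (scale_near hS); near=> e; split; near: e.
    exact: (near_lt_seq3 A (fun x y z => dist (h x) y)).
  exact: (near_lt_seq3 A (fun x y z => dist x y - `|dist x (h z) - dist y (h z)|)).
exists A, e; split=> // k kA kA'; apply: (VW h) => // x y z xA yA zA.
have hz1 := hA _ zA _ xA; have hz2 := hA _ zA _ yA.
have t1 := dist_tri (h z) x y; have t2 := dist_tri y x (h z).
have t3 := dist_tri x y (h z).
rewrite !(distC (h z)) in hz1 hz2 t1; rewrite (distC y x) in t3.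
have [exy|] := eqVneq (dist x y) 0.
  have <- : x = y by exact/dist_eq0.
  rewrite subrr normr0 dist_ge0 distC; split=> //.
  by have := kA _ xA; have := eA _ _ z zA xA zA; rewrite (distC (h z)) => /(_ hz1); lra.
rewrite neq_lt ltNge dist_ge0 /= => xy.
have [xyb|bxy] := boolP ((dist x y)%:E < b)%E.
  by rewrite (distC x (k y)) kA' // 1?distC //; split=> //; rewrite ler_norml; apply/andP; split; lra.
have xyM v w : dist v w <= dist x y.
  by rewrite -lee_fin; apply: le_trans (dist_le_b v w) _; rewrite leNgt.
split; first by apply: (le_trans (xyM _ _)).
have hd : 0 < dist x y - `|dist x (h z) - dist y (h z)|.
  by rewrite subr_gt0 ltr_norml; have := xyM x (h z); have := xyM y (h z) => *; apply/andP; split; lra.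
have := eA' _ _ _ xA yA zA hd; have := kA _ yA; have := dist_tri (k y) x y.
by lra.
Unshelve. all: by end_near. Qed.

End CoarseFilters.

(** * Filters missing a stationary set: general position *)

Section NotPointwise.
Context {R : realType} {S : set R} {b : \bar R} (U : metricSpace S b).
Context (hS : dense_scale S b) (Ury : urysohn U).
Context (F : set_system (Isom U)) (gF : group_filter F).
Context (Fst : forall V, F V -> exists A : seq U, forall g, fixes A g -> V g).
Context (Fm : forall (u : U) e, Sb S b e -> 0 < e -> F [set g | dist (g u) u <= e]).
Implicit Types (x y z u v a c : U) (f g h k : Isom U) (A C : seq U).
Implicit Types (V W : set (Isom U)) (s r e : R).

Local Instance Ffilter' : Filter F := group_filter_filter gF.

Definition increases s := forall V u v, F V -> dist u v = s ->
  exists2 g, V g & s < dist (g u) v.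

Definition decreases s := forall V u v, F V -> dist u v = s ->
  exists2 g, V g & dist (g u) v < s.

Lemma not_filter_increases u v :
  ~ F [set g | dist (g u) v <= dist u v] -> increases (dist u v).
Proof.
move=> uvF V u' v' FV uv'; apply: contrapT => nV; apply: uvF.
apply: (coarse_pair_homogeneous Ury gF (P := fun r => r <= dist u v) uv').
apply: filterS FV => g Vg /=; rewrite leNgt; apply/negP => gu.
by apply: nV; exists g.
Qed.

Lemma not_filter_decreases u v :
  ~ F [set g | dist u v <= dist (g u) v] -> decreases (dist u v).
Proof.
move=> uvF V u' v' FV uv'; apply: contrapT => nV; apply: uvF.
apply: (coarse_pair_homogeneous Ury gF (P := fun r => dist u v <= r) uv').
apply: filterS FV => g Vg /=; rewrite leNgt; apply/negP => gu.
by apply: nV; exists g.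
Qed.

(** Choose v at distance s from a so that the relevant points c lie on geodesics from a to v: moving
    a away from v moves it away from each c. *)
Lemma increases_point s : Sb S b s -> increases s -> forall V a C, F V ->
  exists2 g, V g & forall c, c \in C -> 2 * dist a c <= s -> dist a c < dist (g a) c.
Proof.
move=> sb si V a C FV; have s0 : 0 <= s by have [_ /andP[]] := sb.
pose X := a :: [seq c <- C | 2 * dist a c <= s].
have aX x : x \in X -> 2 * dist a x <= s.
  by rewrite in_cons mem_filter => /predU1P[->|/andP[]//]; rewrite distxx mulr0.
have [x xX|x y xX yX|v vX] := one_point_extension hS Ury (X := X) (p := fun x => s - dist a x).
- have := aX _ xX; have := dist_ge0 a x => *; apply: (Sb_lower sb); try lra.
  by apply: (scaleB hS); [exact: sb.1|exact: (dist_in _ _).1].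
- have := aX _ xX; have := aX _ yX; have := dist_tri x a y; have := dist_tri a x y.
  by rewrite (distC x a) (distC y x) => *; split; lra.
have [|g Vg gv] := si V a v FV; first by rewrite distC vX ?mem_head // distxx subr0.
exists g => // c cC ac; have := dist_tri c (g a) v; rewrite (distC c) vX; first lra.
by rewrite in_cons mem_filter ac cC orbT.
Qed.

(** Choose v so that a lies on geodesics from v to the relevant points c: moving a towards v moves
    it away from each c. *)
Lemma decreases_point s : Sb S b s -> decreases s -> forall V a C, F V ->
  exists2 g, V g & forall c, c \in C -> ((s + dist a c)%:E <= b)%E ->
    dist a c < dist (g a) c.
Proof.
move=> sb sd V a C FV; have s0 : 0 <= s by have [_ /andP[]] := sb.
pose X := a :: [seq c <- C | ((s + dist a c)%:E <= b)%E].
have aX x : x \in X -> ((s + dist a x)%:E <= b)%E.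
  rewrite in_cons mem_filter => /predU1P[->|/andP[]//].
  by rewrite distxx addr0; have [_ /andP[]] := sb.
have [x xX|x y xX yX|v vX] := one_point_extension hS Ury (X := X) (p := fun x => s + dist a x).
- split=> /=; last by rewrite aX // lee_fin addr_ge0 // dist_ge0.
  by apply: (scaleD hS); [exact: sb.1|exact: (dist_in _ _).1].
- have := dist_tri y a x; have := dist_tri a x y.
  by rewrite (distC x a) => *; split; lra.
have [|g Vg gv] := sd V a v FV; first by rewrite distC vX ?mem_head // distxx addr0.
exists g => // c cC ac; have := dist_tri (g a) v c; rewrite (distC v (g a)) vX; first lra.
by rewrite in_cons mem_filter ac cC orbT.
Qed.

(** Of the triangle inequalities for c, c' and x, only the one bounding d(c, c') is made strict;
    [generic_amalgam] gives the rest. The case c = c' says that x is not in [C]. *)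
Definition half_generic x C := forall c c', c \in C -> c' \in C ->
  ((dist c c')%:E < b)%E -> dist c c' < dist c x + dist x c'.

Lemma lt_top_lt r s : (r%:E < b)%E -> (b <= s%:E)%E -> r < s.
Proof. by move=> rb bs; rewrite -lte_fin; exact: lt_le_trans rb bs. Qed.

(** Strictness passes from pairs in [C] to arbitrary pairs: if the shortest paths use c and c', go
    from y to y' through them. If d(c, c') = b, it already exceeds d(y, y'). *)
Lemma half_generic_hop M C x y y' : Sb S b M -> half_generic x C ->
  ((dist y y')%:E < b)%E -> dist y y' < M ->
  dist y y' < hop M C x y + hop M C x y'.
Proof.
move=> Mb xC yb yM.
have [_ /andP[+ _]] := hop_in hS C x y Mb; have [_ /andP[+ _]] := hop_in hS C x y' Mb.
rewrite !lee_fin; have [->|[c cC ->]] := hop_cases M C x y; first lra.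
have [->|[c' c'C ->]] := hop_cases M C x y'; first lra.
move=> _ _; have := dist_tri c y y'; have := dist_tri c' c y'.
have := dist_tri x c c'; rewrite (distC x c) (distC y c).
have [/(xC _ _ cC c'C)|bc] := ltP (dist c c')%:E b; first lra.
have := lt_top_lt yb bc; have := dist_ge0 c y; have := dist_ge0 c' y'; lra.
Qed.

Lemma half_generic_of_decreases :
  (forall e, 0 < e -> exists s, [/\ Sb S b s, 0 < s < e & decreases s]) ->
  forall V A C, F V -> exists2 h, V h & forall a, a \in A -> half_generic (h a) C.
Proof.
move=> dec; apply: (@coarse_propagation _ _ _ _ _ gF Fst (fun _ x C => half_generic x C)).
- move=> V C a FV aC.
  (* Below this e, [decreases_point] covers every c with d(a, c) < b, while a point at distance b
     from a stays farther than any d(c, c') < b. *)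
  have [e [eb e0 [eC eC']]] : exists e, [/\ Sb S b e, 0 < e &
      (forall c, c \in C -> ((dist a c)%:E < b)%E -> ((e + dist a c)%:E < b)%E) /\
      (forall p, p \in [seq (c, c') | c <- C, c' <- C] ->
        ((dist p.1 p.2)%:E < b)%E -> ((e + dist p.1 p.2)%:E < b)%E)].
    apply: (scale_near hS); apply: filterI.
      apply: (@filter_seq _ _ _ C (fun c e => ((dist a c)%:E < b)%E -> ((e + dist a c)%:E < b)%E)) => c _.
      have [/(near_addb hS)|nb] := pselect ((dist a c)%:E < b)%E; first by apply: filterS.
      by apply: filterS filterT.
    apply: (@filter_seq _ _ _ _ (fun p e => ((dist p.1 p.2)%:E < b)%E -> ((e + dist p.1 p.2)%:E < b)%E)) => c _.
    have [/(near_addb hS)|nb] := pselect ((dist c.1 c.2)%:E < b)%E; first by apply: filterS.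
    by apply: filterS filterT.
  have [s [sb /andP[s0 se] sd]] := dec e e0.
  have [g [Vg ga] gC] := decreases_point sb sd a C (filterI FV (Fm a eb e0)).
  have gC1 c : c \in C -> ((dist a c)%:E < b)%E -> dist a c < dist (g a) c.
    move=> cC acb; apply: gC => //; apply: le_trans (ltW (eC _ cC acb)).
    by rewrite lee_fin; lra.
  have gC2 c c' : c \in C -> c' \in C -> ((dist c c')%:E < b)%E ->
      (b <= (dist a c)%:E)%E -> dist c c' < dist (g a) c.
    move=> cC c'C ccb bac; have := lt_top_lt (eC' (c, c') _ ccb) bac.
    rewrite allpairs_f //= => /(_ isT); have := dist_tri (g a) a c.
    by rewrite (distC a (g a)) => ? ?; have /= ? := ga; lra.
  have hg : half_generic (g a) C.
    move=> c c' cC c'C ccb; rewrite (distC c (g a)).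
    have := dist_ge0 (g a) c; have := dist_ge0 (g a) c'.
    have [acb|bac] := ltP (dist a c)%:E b; last by have := gC2 _ _ cC c'C ccb bac; lra.
    have [acb'|bac'] := ltP (dist a c')%:E b; last first.
      by have := gC2 c' c c'C cC; rewrite (distC c') => /(_ ccb bac'); lra.
    have := gC1 _ cC acb; have := gC1 _ c'C acb'; have := dist_tri a c c'.
    by rewrite (distC c a) => *; lra.
  (* Being half generic is stable under moves of size m; the factor 2 accounts for the two distances
     that change. *)
  have [m [mb m0 mC]] : exists m, [/\ Sb S b m, 0 < m & forall c c' c'', c \in C -> c' \in C -> c'' \in C ->
      0 < (dist c (g a) + dist (g a) c' - dist c c') / 2 ->
      m < (dist c (g a) + dist (g a) c' - dist c c') / 2].
    by apply: (scale_near hS); exact: near_lt_seq3.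
  exists [set h | dist (h a) a <= m]; first exact: Fm.
  move=> h ha; exists g => // f fC c c' cC c'C ccb.
  have gh : dist (g (f (h a))) (g a) <= m by rewrite isometry_dist -{2}(fC _ aC) isometry_dist.
  have := hg _ _ cC c'C ccb => hc; have := mC _ _ _ cC c'C cC.
  have := dist_tri (g (f (h a))) c (g a); have := dist_tri (g (f (h a))) (g a) c'.
  by rewrite (distC (g a) (g (f _))) => ? ? /(_ ltac:(lra)); lra.
- move=> C C' CC'; exists setT; first exact: filterT.
  move=> g h A _ _ hA; have [K CK] := dist_bounded C.
  have [M [f [[Mb _ _ ltM] fC' fA]]] :=
    free_amalgam hS Ury C' (map h A) (map (g^-1)%g C) K.
  exists f => // a aA c c' cC c'C ccb.
  rewrite (distC (g _)) -!(dist_isometry_inv g) (distC ((g^-1)%g c')) (distC ((g^-1)%g c)).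
  rewrite !fA ?map_f // -(isometry_dist (g^-1)%g).
  by apply: half_generic_hop => //; rewrite ?isometry_dist //; [exact: hA|apply: ltM => //; exact: CK].
- by move=> _ x C C' CC' xC' c c' /CC' cC' /CC' ; exact: xC'.
Qed.

Definition expands r := forall V A, F V -> exists2 h, V h & forall x y,
  x \in A -> y \in A -> dist x y <= dist (h x) y /\
  (dist x y <= r -> ((dist x y)%:E < b)%E -> dist x y < dist (h x) y).

(* Conjugating a free amalgam over [C] by [h] replaces [dist (h x) y] by the    *)
(* shortest path from [h x] to [h y] through [C]: distances do not decrease.    *)
Lemma expands_conj (P : U -> U -> seq U -> Prop) r :
  (forall V A, F V -> exists2 h, V h & forall a, a \in A -> P a (h a) A) ->
  (forall x y z u v C, z \in C -> dist x y <= r -> ((dist x y)%:E < b)%E ->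
     P x u C -> P y v C -> dist x y < dist u z + dist z v) ->
  expands r.
Proof.
move=> allP sumP V A /(coarse_conj gF Fst)[V1 [B [FV1 V1V]]].
have [h V1h hP] := allP _ (B ++ A) FV1; have [K AK] := dist_bounded A.
have [M [f [[Mb M0 leM ltM] fC fA]]] :=
  free_amalgam hS Ury (B ++ A) (map h A) (map h A) K.
exists (h^-1 * f * h)%g => [|x y xA yA].
  by apply: V1V => // x xB; apply: fC; rewrite mem_cat xB.
have -> : (h^-1 * f * h)%g x = (h^-1)%g (f (h x)) by [].
rewrite dist_isometry_inv fA ?map_f //; split=> [|xr xb].
  apply: hop_ge => [|c _]; first by apply: leM; [exact: dist_le_b|exact: AK].
  by rewrite -(isometry_dist h); exact: dist_tri.
apply: hop_gt => [|c cC]; first by apply: ltM => //; exact: AK.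
by apply: (sumP _ _ _ _ _ _ cC) => //; apply: hP; rewrite mem_cat ?xA ?yA orbT.
Qed.

(** A path x, z, y no longer than 2 r has a leg of length at most r, which gets strictly longer
    while the other does not shrink. A leg of length b is already longer than d(x, y). *)
Lemma expands_double r : expands r -> expands (2 * r).
Proof.
move=> er; apply: (@expands_conj (fun x u C => forall y, y \in C ->
  dist x y <= dist u y /\
  (dist x y <= r -> ((dist x y)%:E < b)%E -> dist x y < dist u y))).
  by move=> V A FV; have [h Vh hA] := er V A FV; exists h => // x xA y yA; exact: hA.
move=> x y z u v C zC xyr xyb xu yv.
have [xz uz] := xu z zC; have [yz vz] := yv z zC.
have t1 := dist_tri z x y; have t2 := dist_ge0 x z; have t3 := dist_ge0 y z.
rewrite (distC z y) in t1; rewrite (distC z v).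
have [bx|xb] := leP b (dist x z)%:E; first by have := lt_top_lt xyb bx; lra.
have [xr|rx] := leP (dist x z) r; first by have := uz xr xb; lra.
have [bx|yb] := leP b (dist y z)%:E; first by have := lt_top_lt xyb bx; lra.
have [yr|ry] := leP (dist y z) r; first by have := vz yr yb; lra.
by lra.
Qed.

Lemma expands_all r : 0 < r -> expands r -> forall s, expands s.
Proof.
move=> r0 er s.
have ern n : expands (r * n.+1%:R).
  elim: n => [|n IH]; first by rewrite mulr1.
  move=> V A FV; have [h Vh hA] := expands_double IH A FV; exists h => // x y xA yA.
  have [h1 h2] := hA x y xA yA; split=> // xr; apply: h2; apply: le_trans xr _.
  have n1 : 1 <= n.+1%:R :> R by rewrite ler1n.
  have : r * 1 <= r * n.+1%:R by rewrite ler_pM2l.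
  by rewrite -(natr1 n.+1) mulrDr; lra.
move=> V A FV; have [h Vh hA] := ern (Num.bound (`|s| / r)) V A FV; exists h => // x y xA yA.
have [h1 h2] := hA x y xA yA; split=> // xs; apply: h2; apply: le_trans xs _.
have := ler_norm s; have := normr_ge0 s.
rewrite mulrC -ler_pdivrMr // -natr1 => s0 ss.
have /archi_boundP : 0 <= `|s| / r by rewrite divr_ge0 // ltW.
have : s / r <= `|s| / r by rewrite ler_pM2r ?invr_gt0.
by lra.
Qed.

Lemma half_generic_of_expands : (forall s, expands s) ->
  forall V A C, F V -> exists2 h, V h & forall a, a \in A -> half_generic (h a) C.
Proof.
move=> ex V A C FV; have [K CK] := dist_bounded (A ++ C).
have [h Vh hA] := ex K V (A ++ C) FV; exists h => // a aA c c' cC c'C ccb.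
have aAC : a \in A ++ C by rewrite mem_cat aA.
have cAC x : x \in C -> x \in A ++ C by rewrite mem_cat orbC => ->.
have [h1 h2] := hA _ _ aAC (cAC _ cC); have [h3 h4] := hA _ _ aAC (cAC _ c'C).
have {}h2 := h2 (CK _ _ aAC (cAC _ cC)); have {}h4 := h4 (CK _ _ aAC (cAC _ c'C)).
have := dist_tri a c c'; rewrite (distC c a) (distC c (h a)) => t1.
have [bc|/h2] := leP b (dist a c)%:E; last lra.
have [bc'|/h4] := leP b (dist a c')%:E; last lra.
by have := lt_top_lt ccb bc; have := lt_top_lt ccb bc'; have := dist_ge0 c c'; lra.
Qed.

Section Increasing.
Context (r r' : R) (r_gt0 : 0 < r) (r_lt : r < r') (r_ltb : (r%:E < b)%E).
Context (inc : forall V a C, F V -> exists2 g, V g &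
  forall c, c \in C -> dist a c <= r' -> dist a c < dist (g a) c).
Context (noshrink : forall u v, 0 < dist u v <= r' ->
  F [set g | dist u v <= dist (g u) v]).

Lemma min_dist_tri x z y :
  Num.min (dist x y) r <= Num.min (dist x z) r + Num.min (dist z y) r.
Proof.
have := dist_tri z x y; have := dist_ge0 x z; have := dist_ge0 z y; move: r_gt0.
by rewrite /Num.min; case: ifP; case: ifP; case: ifP => *; lra.
Qed.

(** Distances up to r' do not shrink near 1; longer ones stay above r because g moves points by less
    than r' - r. *)
Lemma far_noshrink C : F [set g | forall z, z \in C -> forall c, c \in C ->
  Num.min (dist z c) r <= dist (g z) c].
Proof.
apply: filter_seq => z _; apply: filter_seq => c _.
have [|zc] := ltP 0 (dist z c); last first.
  apply: filterS filterT => g _; apply: le_trans (dist_ge0 _ _).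
  by rewrite ge_min zc.
move=> zc0; have [zcr|rzc] := leP (dist z c) r'.
  by apply: filterS (@noshrink z c _) => [g /= ?|]; rewrite ?zc0 // ge_min; apply/orP; left.
have [e [eb e0 er]] : exists e, [/\ Sb S b e, 0 < e & e < r' - r].
  by apply: (scale_near hS); apply: nbhs_right_lt; rewrite subr_gt0.
apply: filterS (Fm z eb e0) => g /= gz; rewrite ge_min; apply/orP; right.
by have := dist_tri (g z) z c; rewrite (distC z (g z)); lra.
Qed.

(** The truncation of the metric at r is again a metric. Along a path through z the first leg
    exceeds its truncated value and, by [far_noshrink], the second is at least its own. *)
Lemma far_min V A C : F V -> exists2 h, V h & forall a, a \in A ->
  forall c, c \in C -> Num.min (dist a c) r < dist (h a) c.
Proof.
apply: (@coarse_propagation _ _ _ _ _ gF Fst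
  (fun a x C => forall c, c \in C -> Num.min (dist a c) r < dist x c)).
- move=> {}V {}C a FV aC.
  have [e [eb e0 er]] : exists e, [/\ Sb S b e, 0 < e & e < r' - r].
    by apply: (scale_near hS); apply: nbhs_right_lt; rewrite subr_gt0.
  have [g [Vg /= ga] gC] := inc a C (filterI FV (Fm a eb e0)).
  have {}gC c : c \in C -> Num.min (dist a c) r < dist (g a) c.
    move=> cC; rewrite gt_min; have [|acr] := leP (dist a c) r'.
      by move/(gC _ cC) => ->.
    by apply/orP; right; have := dist_tri (g a) a c; rewrite (distC a (g a)); lra.
  have [m [mb m0 mC]] : exists m, [/\ Sb S b m, 0 < m & forall c c' c'',
      c \in C -> c' \in C -> c'' \in C -> 0 < dist (g a) c - Num.min (dist a c) r ->
      m < dist (g a) c - Num.min (dist a c) r].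
    apply: (scale_near hS).
    exact: (near_lt_seq3 C (fun c _ _ => dist (g a) c - Num.min (dist a c) r)).
  exists [set h | dist (h a) a <= m]; first exact: Fm.
  move=> h ha; exists g => // f fC c cC.
  have gh : dist (g (f (h a))) (g a) <= m by rewrite isometry_dist -{2}(fC _ aC) isometry_dist.
  have := gC _ cC; have := mC _ _ _ cC cC cC; have := dist_tri (g (f (h a))) (g a) c.
  by rewrite (distC (g a) (g (f _))) subr_gt0 => ? m1 /[dup] /m1; lra.
- move=> {}C C' CC'; exists [set g | forall z, z \in C' -> forall c, c \in C' ->
    Num.min (dist z c) r <= dist (g z) c]; first exact: far_noshrink.
  move=> g h {}A gC' _ hA.
  have [M [f [[_ _ _ ltM] fC' fA]]] :=
    free_amalgam hS Ury C' (map h A) (map (g^-1)%g C) r.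
  exists f => // a aA c cC.
  rewrite (distC (g _)) -(dist_isometry_inv g) (distC ((g^-1)%g c)).
  rewrite fA ?map_f //; apply: hop_gt => [|z zC'].
    by rewrite gt_min (ltM _ r_ltb (lexx _)) orbT.
  rewrite (distC z) dist_isometry_inv (distC c).
  apply: le_lt_trans (min_dist_tri a z c) _.
  by have := hA _ aA _ zC'; have := gC' _ zC' _ (CC' _ cC); lra.
- by move=> a x {}C C' CC' C'P c /CC'; exact: C'P.
Qed.

Lemma expands_of_increases : expands r.
Proof.
apply: (@expands_conj (fun x u C => forall c, c \in C -> Num.min (dist x c) r < dist u c)).
  by move=> V A FV; exact: far_min.
move=> x y z u v C zC xyr _ xu yv; have := min_dist_tri x z y.
rewrite (min_idPl xyr) (distC z y) (distC z v).
by have := xu _ zC; have := yv _ zC; lra.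
Qed.

End Increasing.

(* Either arbitrarily short distances can be decreased, which moves a point     *)
(* away from all the points at distance less than [b], or short distances do    *)
(* not decrease near 1, and then increasing distances at a small scale          *)
(* propagates to all scales by doubling.                                        *)
Lemma coarse_half_generic u v : 0 < dist u v -> ((dist u v)%:E < b)%E ->
  ~ F [set g | dist (g u) v = dist u v] ->
  forall V A C, F V -> exists2 h, V h & forall a, a \in A -> half_generic (h a) C.
Proof.
move=> uv0 uvb uvF; set s := dist u v in uv0 uvb *.
have sb : Sb S b s by exact: dist_in.
(* Both [increases_point] and [decreases_point] apply to points within e of a, so whichever way d(u,
   v) = s changes, short distances can be increased. *)
have [e [eb e0 [es eb']]] : exists e, [/\ Sb S b e, 0 < e &
    2 * e <= s /\ ((e + s)%:E < b)%E].
  apply: (scale_near hS); apply: filterI; last exact: (near_addb hS).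
  have s2 : 0 < s / 2 by lra.
  by near=> e; suff : e < s / 2 by lra; near: e; exact: nbhs_right_lt.
have inc V a C : F V -> exists2 g, V g &
    forall c, c \in C -> dist a c <= e -> dist a c < dist (g a) c.
  move=> FV; have [inc|dec] : increases s \/ decreases s.
  - have [le|nle] := pselect (F [set g | dist (g u) v <= s]); last first.
      by left; exact: not_filter_increases.
    right; apply: not_filter_decreases => ge; apply: uvF.
    apply: filterS (filterI le ge) => g [/= gle gge]; apply/eqP.
    by rewrite eq_le gle gge.
  - have [g Vg gC] := increases_point sb inc a C FV.
    by exists g => // c cC ac; apply: gC => //; lra.
  - have [g Vg gC] := decreases_point sb dec a C FV.
    exists g => // c cC ac; apply: gC => //; apply: le_trans (ltW eb').
    by rewrite lee_fin; lra.
have [dec|ndec] := pselect (forall e, 0 < e ->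
    exists s, [/\ Sb S b s, 0 < s < e & decreases s]).
  exact: half_generic_of_decreases.
have [d d0 dP] : exists2 d : R, 0 < d & forall s, Sb S b s -> 0 < s < d -> ~ decreases s.
  apply: contrapT => nd; apply: ndec => d d0; apply: contrapT => nds.
  by apply: nd; exists d => // t tb td dt; apply: nds; exists t.
have [r' [r'0 r'e r'd]] : exists r' : R, [/\ 0 < r', r' <= e & r' < d].
  have [ed|de] := ltP e d; first by exists e.
  by exists (d / 2); split; lra.
apply: half_generic_of_expands; apply: (@expands_all (r' / 2)); first lra.
apply: (@expands_of_increases (r' / 2) r'); [lra|lra|..].
- by have [_ /andP[_]] := eb; apply: lt_le_trans; rewrite lte_fin; lra.
- move=> V a C FV; have [g Vg gC] := inc V a C FV; exists g => // c cC ac.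
  by apply: gC => //; lra.
- move=> x y /andP[xy0 xyr]; apply: contrapT => /not_filter_decreases.
  by apply: dP; [exact: dist_in|apply/andP; split; lra].
Unshelve. all: by end_near. Qed.

End NotPointwise.

(** * From half generic to generic position *)

Lemma count_le_lt (R : realType) (L : seq R) (s t : R) : s < t -> t \in L ->
  (count (fun r => (r <= s)%R) L < count (fun r => (r <= t)%R) L)%N.
Proof.
move=> st; have sub r : r <= s -> r <= t by move=> rs; exact: le_trans rs (ltW st).
elim: L => //= r L IH; rewrite in_cons => /predU1P[<-|tL].
  by rewrite lexx [t <= s]leNgt st add0n add1n ltnS; apply: sub_count => ? /=; exact: sub.
by rewrite -addnS; apply: leq_add; [case: leP => // /sub ->|exact: IH].
Qed.

Section Generic.
Context {R : realType} {S : set R} {b : \bar R} (U : metricSpace S b).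
Context (hS : dense_scale S b) (Ury : urysohn U).
Implicit Types (x y z u v a c : U) (f g h k : Isom U) (A C X : seq U).

(* The values of the free amalgam are decreased by small multiples of [t], the *)
(* multiple growing with the value: this makes the triangle inequalities       *)
(* strict while keeping the distances in [S].                                  *)
Lemma generic_amalgam C X : (forall x, x \in X -> half_generic x C) ->
  exists f, fixes C f /\ forall x y z, x \in X -> y \in X -> z \in X ->
    dist x y < dist (f x) z + dist (f y) z /\
    (x != y -> `|dist (f x) z - dist (f y) z| < dist x y).
Proof.
move=> XC; have [K XCK] := dist_bounded (X ++ C).
have [M [Mb M0 leM ltM _]] := dist_cap hS (X ++ C) K.
have XM x y : x \in X ++ C -> y \in X ++ C -> dist x y <= M.
  by move=> xX yX; apply: leM; [exact: dist_le_b|exact: XCK].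
have XMlt x y : x \in X ++ C -> y \in X ++ C -> ((dist x y)%:E < b)%E -> dist x y < M.
  by move=> xX yX xyb; apply: ltM => //; exact: XCK.
have XX x : x \in X -> x \in X ++ C by rewrite mem_cat => ->.
have CX x : x \in C -> x \in X ++ C by rewrite mem_cat orbC => ->.
have b0 : ((0 : R)%:E < b)%E.
  by have [_ /andP[_]] := Mb; apply: lt_le_trans; rewrite lte_fin.
have XC0 x c : x \in X -> c \in C -> 0 < dist x c.
  by move=> /XC xC cC; have := xC c c cC cC; rewrite !distxx (distC c) => /(_ b0); lra.
have CC x c c' : x \in X -> c \in C -> c' \in C ->
    dist c c' < dist c x + dist x c' \/ (b <= (dist c c')%:E)%E.
  move=> xX cC c'C; have [ccb|] := ltP (dist c c')%:E b; last by right.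
  by left; exact: (XC x).
have le_b x y c c' : (b <= (dist c c')%:E)%E -> dist x y <= dist c c'.
  by move=> bc; rewrite -lee_fin; exact: le_trans (dist_le_b x y) bc.
pose hi x y := hop M C x y.
have hi_gt0 x y : x \in X -> 0 < hi x y.
  move=> xX; apply: hop_gt => // c cC.
  by have := XC0 _ _ xX cC; have := dist_ge0 c y; lra.
have hi_lo x y c : x \in X -> y \in X -> c \in C -> dist x c - dist c y < hi x y.
  move=> xX yX cC; apply: hop_gt => [|c' c'C].
    by have := XM _ _ (XX _ xX) (CX _ cC); have := XC0 _ _ yX cC; rewrite (distC c); lra.
  have := dist_tri c' x c; have := XC0 _ _ xX c'C; rewrite (distC c y).
  have [|/le_b] := CC _ _ _ yX c'C cC; first lra.
  have := dist_tri y c' c => ? le_cc' ? ?.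
  by have := le_cc' x c; have := XC0 _ _ yX cC; lra.
have hi_sum x x' y : x \in X -> x' \in X -> y \in X -> dist x x' < hi x y + hi x' y.
  move=> xX x'X yX; have := hi_gt0 _ y xX; have := hi_gt0 _ y x'X; rewrite /hi.
  have := XM _ _ (XX _ xX) (XX _ x'X); have [->|[c cC ->]] := hop_cases M C x y; first lra.
  have [->|[c' c'C ->]] := hop_cases M C x' y; first lra.
  have := XC0 _ _ xX cC; have := dist_tri c x x'; have := dist_tri c' c x'.
  rewrite (distC c' x') (distC c' y).
  have [|/le_b le_cc'] := CC _ _ _ yX cC c'C; first lra.
  by have := le_cc' x x'; have := dist_tri y c c'; have := dist_ge0 x' c'; lra.
have [d [db d0 [d1 d2 d3 d4]]] : exists d, [/\ Sb S b d, 0 < d & [/\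
    forall x y c, x \in X ++ C -> y \in X ++ C -> c \in X ++ C ->
      0 < hi x y -> d < hi x y,
    forall x y c, x \in X ++ C -> y \in X ++ C -> c \in X ++ C ->
      0 < hi x y - (dist x c - dist c y) -> d < hi x y - (dist x c - dist c y),
    forall x y c, x \in X ++ C -> y \in X ++ C -> c \in X ++ C ->
      0 < (hi x c + hi y c - dist x y) / 2 -> d < (hi x c + hi y c - dist x y) / 2 &
    forall x y c, x \in X ++ C -> y \in X ++ C -> c \in X ++ C ->
      0 < dist x y -> d < dist x y]].
  apply: (scale_near hS); near=> d; split; near: d.
  - exact: (near_lt_seq3 _ (fun x y c => hi x y)).
  - exact: (near_lt_seq3 _ (fun x y c => hi x y - (dist x c - dist c y))).
  - exact: (near_lt_seq3 _ (fun x y c => (hi x c + hi y c - dist x y) / 2)).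
  - exact: (near_lt_seq3 _ (fun x y c => dist x y)).
pose L := [seq hi x y | x <- X, y <- X].
have [t [St /andP[t0 td]]] : exists t, S t /\ 0 < t < d / (size L).+1%:R.
  by apply: (scale_between hS); rewrite divr_gt0.
(* The correction is t times the rank of the value in [L]: strictly monotone on these values, and
   below d in total. *)
pose q x y := t *+ count (fun r => (r <= hi x y)%R) L.
have q0 x y : 0 <= q x y by rewrite mulrn_wge0 // ltW.
have qd x y : q x y < d.
  apply: (@le_lt_trans _ _ (t *+ (size L).+1)).
    by apply: ler_wpMn2l; [exact: ltW|exact: leq_trans (count_size _ _) _].
  by rewrite -mulr_natr -ltr_pdivlMr.
have qlt x y x' y' : x' \in X -> y' \in X -> hi x y < hi x' y' -> q x y < q x' y'.
  move=> x'X y'X hlt; rewrite ltr_pMn2l //; apply: count_le_lt => //.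
  by apply: allpairs_f.
pose r x y := hi x y - q x y.
have rC x y : r x y = r y x by rewrite /r /q /hi hopC.
(* If hi x y <= hi x' y, then d(x, x') > d absorbs the corrections; otherwise x, y has the larger
   correction, which makes [hop_ler] strict. *)
have r_strict x x' y : x \in X -> x' \in X -> y \in X -> x != x' ->
    r x y < dist x x' + r x' y.
  move=> xX x'X yX xx'; have := d4 _ _ _ (XX _ xX) (XX _ x'X) (XX _ yX) (dist_gt0 xx').
  have := hop_ler M C x x' y; rewrite -/(hi x y) -/(hi x' y) /r.
  have [le _ dx|lt] := leP (hi x y) (hi x' y).
    by have := qd x' y; have := q0 x y; lra.
  by have := qlt _ _ _ _ xX yX lt; lra.
have r_ler x x' y : x \in X -> x' \in X -> y \in X -> r x y <= dist x x' + r x' y.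
  move=> xX x'X yX; have [->|xx'] := eqVneq x x'; first by rewrite distxx add0r.
  exact/ltW/r_strict.
have r_sum x x' y : x \in X -> x' \in X -> y \in X -> dist x x' < r x y + r x' y.
  move=> xX x'X yX; have := hi_sum _ _ _ xX x'X yX.
  have := d3 _ _ _ (XX _ xX) (XX _ x'X) (XX _ yX).
  rewrite /r; have := qd x y; have := qd x' y => ? ? dsum sum.
  by have := dsum ltac:(lra); lra.
have r_lo x y c : x \in X -> y \in X -> c \in C -> dist x c <= r x y + dist c y.
  move=> xX yX cC; have := hi_lo _ _ _ xX yX cC => lo.
  have := d2 _ _ _ (XX _ xX) (XX _ yX) (CX _ cC) ltac:(lra).
  by rewrite /r; have := qd x y; lra.
have [||||f [fC fX]] := @amalgam _ _ _ U Ury C X X r.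
- move=> x y xX yX; apply: (@Sb_lower _ _ _ (hi x y)); first exact: hop_in.
  + by apply: (scaleB hS); [exact: (hop_in hS _ _ _ Mb).1|exact: (scaleMn hS)].
  + have := d1 _ _ _ (XX _ xX) (XX _ yX) (XX _ yX) (hi_gt0 _ _ xX).
    by rewrite /r; have := qd x y; lra.
  + by rewrite /r; have := q0 x y; lra.
- move=> x y c xX yX cC; split.
  + by have := hop_le M x y cC; have := q0 x y; rewrite /r /hi; lra.
  + exact: r_lo.
  + by rewrite rC (distC c) (distC x); exact: r_lo.
- by move=> x x' y xX x'X yX; split; [exact: r_ler|exact/ltW/r_sum].
- move=> x y y' xX yX y'X; rewrite !(rC x); split; last exact/ltW/r_sum.
  by rewrite addrC distC; exact: r_ler.
exists f; split=> // x y z xX yX zX; rewrite !fX //; split; first exact: r_sum.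
move=> xy; have := r_strict _ _ _ xX yX zX xy.
rewrite eq_sym in xy; have := r_strict _ _ _ yX xX zX xy; rewrite (distC y x) => *.
by rewrite ltr_norml; apply/andP; split; lra.
Unshelve. all: by end_near. Qed.

Context (F : set_system (Isom U)) (gF : group_filter F).
Context (Fst : forall V, F V -> exists A : seq U, forall g, fixes A g -> V g).

(** After conjugation by h, the amalgam of [generic_amalgam] yields g in V with all triangle
    inequalities between [A] and g A strict, so k may differ from the identity on [A] by a small
    e. *)
Lemma coarse_of_half_generic :
  (forall V A C, F V -> exists2 h, V h & forall a, a \in A -> half_generic (h a) C) ->
  forall W, F W -> exists A (e : R), [/\ Sb S b e, 0 < e &
    forall k, (forall x, x \in A -> dist (k x) x <= e) -> W k].
Proof.
move=> hg W /(coarse_double_coset Ury gF Fst)[V [A [FV AV VW]]].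
have [V1 [B [FV1 V1V]]] := coarse_conj gF Fst FV.
have [h V1h hA] := hg V1 A (B ++ A) FV1.
have [_ /mapP[a aA ->]|f [fC fA]] := @generic_amalgam (B ++ A) (map h A); first exact: hA.
pose g : Isom U := (h^-1 * f^-1 * h)%g.
have Vg : V g.
  apply: V1V => // x xB; have fx : f x = x by apply: fC; rewrite mem_cat xB.
  by rewrite -{1}fx isometry_mulVK.
have gE x z : dist x (g z) = dist (f (h x)) (h z).
  change (dist x ((h^-1)%g ((f^-1)%g (h z))) = dist (f (h x)) (h z)).
  by rewrite distC !dist_isometry_inv distC.
have {}fA x y z : x \in A -> y \in A -> z \in A ->
    dist x y < dist x (g z) + dist y (g z) /\
    (x != y -> `|dist x (g z) - dist y (g z)| < dist x y).
  move=> xA yA zA; rewrite !gE -(isometry_dist h x y).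
  have [|//|//|fs fd] := fA (h x) (h y) (h z); rewrite ?map_f //; split=> // xy.
  apply: fd; apply: contra xy => /eqP hxy.
  by apply/eqP/dist_eq0; rewrite -(isometry_dist h) hxy distxx.
have [e [eb e0 [e1 e2]]] : exists e, [/\ Sb S b e, 0 < e &
    (forall x y z, x \in A -> y \in A -> z \in A ->
      0 < dist x (g z) + dist y (g z) - dist x y ->
      e < dist x (g z) + dist y (g z) - dist x y) /\
    (forall x y z, x \in A -> y \in A -> z \in A ->
      0 < dist x y - `|dist x (g z) - dist y (g z)| ->
      e < dist x y - `|dist x (g z) - dist y (g z)|)].
  apply: (scale_near hS); near=> e; split; near: e.
    exact: (near_lt_seq3 _ (fun x y z => dist x (g z) + dist y (g z) - dist x y)).
  exact: (near_lt_seq3 _ (fun x y z => dist x y - `|dist x (g z) - dist y (g z)|)).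
exists A, e; split=> // k kA; apply: (VW g) => // x y z xA yA zA.
have [f1 f2] := fA _ _ _ xA yA zA.
have ky := kA _ yA; have t1 := dist_tri y x (k y); have t2 := dist_tri (k y) x y.
rewrite (distC y) in t1.
have f1' := e1 _ _ _ xA yA zA ltac:(lra); split; first lra.
have [exy|/f2 {}f2] := eqVneq x y; first by rewrite exy subrr normr0 dist_ge0.
by have f2' := e2 _ _ _ xA yA zA ltac:(lra); lra.
Unshelve. all: by end_near. Qed.

End Generic.

(** * The four topologies *)

Section FourTopologies.
Context {R : realType} {S : set R} {b : \bar R} (U : metricSpace S b).
Context (hS : dense_scale S b) (Ury : urysohn U).
Implicit Types (x y z u v w : U) (f g h k : Isom U) (A C : seq U).
Implicit Types (W : set (Isom U)).

Definition st_filter : set_system (Isom U) :=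
  subbase_filter (fun _ : U => True) (fun u => [set g : Isom U | g u = u]).

Definition m_filter : set_system (Isom U) :=
  subbase_filter (fun p : U * R => [/\ S p.2, 0 < p.2 & (p.2%:E <= b)%E])
    (fun p => [set g : Isom U | dist (g p.1) p.1 <= p.2]).

(* For finite [b] only the distances below [b] are used: the finite             *)
(* intersections of all the stationary sets are not a base at the identity.     *)
Definition stationary_filter : set_system (Isom U) :=
  subbase_filter (fun p : U * U => 0 < dist p.1 p.2 /\ ((dist p.1 p.2)%:E < b)%E)
    (fun p => [set g : Isom U | dist (g p.1) p.2 = dist p.1 p.2]).

Definition all_stationary_filter : set_system (Isom U) :=
  subbase_filter (fun p : U * U => 0 < dist p.1 p.2)
    (fun p => [set g : Isom U | dist (g p.1) p.2 = dist p.1 p.2]).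

Lemma two_point_extension u v (r s : R) : Sb S b r -> Sb S b s ->
  `|r - s| <= dist u v -> dist u v <= r + s ->
  exists w, dist w u = r /\ dist w v = s.
Proof.
move=> rb sb; rewrite ler_norml => /andP[rs1 rs2] rs3.
have r0 : 0 <= r by have [_ /andP[]] := rb.
have s0 : 0 <= s by have [_ /andP[]] := sb.
have [uv|uv] := eqVneq u v.
  have {uv} uv : dist u v = 0 by rewrite uv distxx.
  have [x _|x y|w wX] := one_point_extension hS Ury (X := [:: u]) (p := fun=> r) => //.
    rewrite !inE => -> ->; rewrite distxx addr0; split=> //; lra.
  have wu := wX u (mem_head _ _); exists w; split=> //.
  have /dist_eq0 <- := uv; rewrite wu; lra.
have vu : (v == u) = false by rewrite eq_sym (negbTE uv).
have [x _|x y|w wX] := one_point_extension hS Ury (X := [:: u; v])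
    (p := fun x => if x == u then r else s).
- by case: ifP.
- rewrite !in_cons !in_nil !orbF => /orP[]/eqP-> /orP[]/eqP->; rewrite ?eqxx ?vu ?distxx.
  + by split; lra.
  + by rewrite (distC v u); split; lra.
  + by rewrite (distC v u); split; lra.
  + by split; lra.
exists w; rewrite !wX ?eqxx ?vu //; first by rewrite in_cons mem_head orbT.
exact: mem_head.
Qed.

Lemma st_group_filter : group_filter st_filter.
Proof.
have N u := @subbase_filter_gen (Isom U) _ (fun _ => True) (fun u => [set g | g u = u]) u I.
have FF := @subbase_filter_filter (Isom U) _ (fun _ => True) (fun u : U => [set g : Isom U | g u = u]).
apply: subbase_group_filter => //.
- move=> u _; exists [set g : Isom U | g u = u]; first exact: N.
  by move=> g h /= gu hu; change (g (h u) = u); rewrite hu.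
- move=> u _; apply: filterS (N u) => g /= gu.
  by rewrite -{1}gu isometry_mulVK.
- move=> u g _; apply: filterS (N ((g^-1)%g u)) => h /= hu.
  by change (g (h ((g^-1)%g u)) = u); rewrite hu isometry_mulKV.
Qed.

Lemma m_group_filter : group_filter m_filter.
Proof.
pose P (p : U * R) := [/\ S p.2, 0 < p.2 & (p.2%:E <= b)%E].
pose N (p : U * R) := [set g : Isom U | dist (g p.1) p.1 <= p.2].
have FN p : P p -> subbase_filter P N (N p) by exact: subbase_filter_gen.
have FF : Filter (subbase_filter P N) by exact: subbase_filter_filter.
apply: subbase_group_filter => [[u e] [_ e0 _]|[u e] [_ /= e0 _]|[u e] Pe|[u e] g Pe] /=.
- by change (dist u u <= e); rewrite distxx ltW.
- have [d [[Sd /andP[_ db]] d0 de]] : exists d, [/\ Sb S b d, 0 < d & d < e / 2].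
    by apply: (scale_near hS); apply: nbhs_right_lt; lra.
  exists (N (u, d)); first exact: FN.
  rewrite /N => g h /= gu hu; change (dist (g (h u)) u <= e).
  by have := dist_tri (g u) (g (h u)) u; rewrite isometry_dist; lra.
- apply: filterS (FN _ Pe) => g; rewrite /N /=.
  by rewrite dist_isometry_inv distC.
- apply: filterS (FN ((g^-1)%g u, e) Pe) => h; rewrite /N /= => hu.
  by change (dist (g (h ((g^-1)%g u))) u <= e); rewrite distC -dist_isometry_inv distC.
Qed.

(** For products, let r = d(u, v) and take w between u and v at distance s from u, and w' with v
    between u and w' at distance s from w'. Fixing the distances to w bounds d(h u, g^-1 v) above by
    r; fixing those to w' bounds it below. The point w' exists since r + s can be kept below b. *)
Lemma stationary_group_filter : group_filter stationary_filter.
Proof.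
pose P (p : U * U) := 0 < dist p.1 p.2 /\ ((dist p.1 p.2)%:E < b)%E.
pose N (p : U * U) := [set g : Isom U | dist (g p.1) p.2 = dist p.1 p.2].
have FN u v : 0 < dist u v -> ((dist u v)%:E < b)%E -> subbase_filter P N (N (u, v)).
  by move=> uv0 uvb; apply: subbase_filter_gen.
have FF : Filter (subbase_filter P N) by exact: subbase_filter_filter.
apply: subbase_group_filter => [[u v]|[u v] [/= uv0 uvb]|[u v] [/= uv0 uvb]|[u v] g [/= uv0 uvb]] //.
- have rb := dist_in u v; set r := dist u v in uv0 uvb rb.
  have [s [sb s0 [sr srb]]] : exists s, [/\ Sb S b s, 0 < s & s < r /\ ((s + r)%:E < b)%E].
    apply: (scale_near hS); apply: filterI; last exact: (near_addb hS).
    exact: nbhs_right_lt.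
  have rsb : Sb S b (r - s).
    by apply: (Sb_lower rb); [apply: (scaleB hS rb.1 sb.1)|lra|lra].
  have srb' : Sb S b (r + s).
    split; first exact: (scaleD hS rb.1 sb.1).
    by apply/andP; split; [rewrite lee_fin; lra|rewrite addrC ltW].
  have [||w [wu wv]] := two_point_extension (u := u) (v := v) sb rsb.
  + by rewrite -/r ler_norml; apply/andP; split; lra.
  + by rewrite -/r; lra.
  have [||w' [w'u w'v]] := two_point_extension (u := u) (v := v) srb' sb.
  + by rewrite -/r ler_norml; apply/andP; split; lra.
  + by rewrite -/r; lra.
  have ltb t : t <= s + r -> (t%:E < b)%E.
    by move=> tr; apply: le_lt_trans srb; rewrite lee_fin.
  have F1 : subbase_filter P N (N (u, w)) by apply: FN; rewrite distC wu //; apply: ltb; lra.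
  have F2 : subbase_filter P N (N (w, v)) by apply: FN; rewrite wv; [lra|apply: ltb; lra].
  have F3 : subbase_filter P N (N (u, w')) by apply: FN; rewrite distC w'u; [lra|apply: ltb; lra].
  have F4 : subbase_filter P N (N (w', v)) by apply: FN; rewrite w'v //; apply: ltb; lra.
  exists (N (u, w) `&` N (w, v) `&` (N (u, w') `&` N (w', v))).
    by apply: filterI; exact: filterI.
  rewrite /N => g h [[_ /= g2] [_ /= g4]] [[/= h1 _] [/= h3 _]]; change (dist (g (h u)) v = r).
  rewrite distC -dist_isometry_inv distC; apply/eqP; rewrite eq_le.
  have := dist_tri w (h u) ((g^-1)%g v); have := dist_tri ((g^-1)%g v) (h u) w'.
  rewrite (distC _ w') (distC w ((g^-1)%g v)) (distC ((g^-1)%g v) w').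
  rewrite (distC w' ((g^-1)%g v)) !dist_isometry_inv (distC v (g w)) (distC v (g w')).
  rewrite g2 g4 h1 (distC w' (h u)) h3 (distC u w) (distC u w') wu wv w'u w'v => *.
  by apply/andP; split; lra.
- rewrite distC in uv0 uvb; apply: filterS (FN v u uv0 uvb) => g; rewrite /N /=.
  by rewrite dist_isometry_inv distC => ->; rewrite distC.
- have e : dist ((g^-1)%g u) ((g^-1)%g v) = dist u v by rewrite isometry_dist.
  apply: filterS (FN ((g^-1)%g u) ((g^-1)%g v) _ _) => [h||]; rewrite ?e // /N /= e => hu.
  change (dist (g (h ((g^-1)%g u))) v = dist u v).
  by rewrite distC -dist_isometry_inv distC.
Qed.

Lemma m_filter_gen u (e : R) : Sb S b e -> 0 < e ->
  m_filter [set g | dist (g u) u <= e].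
Proof.
move=> [Se /andP[_ eb]] e0.
by apply: (@subbase_filter_gen _ _ _ (fun p : U * R => [set g : Isom U | dist (g p.1) p.1 <= p.2]) (u, e)).
Qed.

Lemma stationary_filter_gen u v : 0 < dist u v -> ((dist u v)%:E < b)%E ->
  stationary_filter [set g | dist (g u) v = dist u v].
Proof.
move=> uv0 uvb.
by apply: (@subbase_filter_gen _ _ _ (fun p : U * U => [set g : Isom U | dist (g p.1) p.2 = dist p.1 p.2]) (u, v)).
Qed.

Lemma m_sub_stationary : m_filter `<=` stationary_filter.
Proof.
have FF := group_filter_filter stationary_group_filter.
apply: subbase_filter_sub => -[u e] [/= Se e0 eb].
have [s [sb s0 se]] : exists s, [/\ Sb S b s, 0 < s & s < e / 2].
  by apply: (scale_near hS); apply: nbhs_right_lt; lra.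
have [||w [wu _]] := two_point_extension (u := u) (v := u) sb sb.
- by rewrite subrr normr0 dist_ge0.
- by rewrite distxx; lra.
apply: filterS (@stationary_filter_gen u w _ _) => [g /= gu||].
- by have := dist_tri w (g u) u; rewrite gu (distC u w) wu; lra.
- by rewrite distC wu.
- by rewrite distC wu; apply: lt_le_trans eb; rewrite lte_fin; lra.
Qed.

Lemma stationary_sub_all : stationary_filter `<=` all_stationary_filter.
Proof.
apply: subbase_filter_sub; first exact: subbase_filter_filter.
by move=> p [p0 _]; exact: subbase_filter_gen.
Qed.

Lemma all_stationary_sub_st : all_stationary_filter `<=` st_filter.
Proof.
have FF := group_filter_filter st_group_filter.
apply: subbase_filter_sub => -[u v] _.
have : st_filter [set g | g u = u] by exact: subbase_filter_gen.
by apply: filterS => g /= ->.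
Qed.

(** Raising distances to at least r, with r below all positive distances of [A], preserves those
    distances but moves u. *)
Lemma stabilizer_not_stationary u : ~ all_stationary_filter [set g | g u = u].
Proof.
move=> [s sP su]; pose A := u :: map fst s ++ map snd s.
have [r [rb r0 rA]] : exists r, [/\ Sb S b r, 0 < r & forall x y z, x \in A -> y \in A ->
    z \in A -> 0 < dist x y -> r < dist x y].
  by apply: (scale_near hS); exact: (near_lt_seq3 A (fun x y _ => dist x y)).
have [x y xA yA|t t' t''|x y xA yA|g gA] := shift_isometry Ury (A := A) (p := fun t => Num.max t r).
- by rewrite /Num.max; case: ifP => // _; exact: dist_in.
- by rewrite /Num.max; case: ifP; case: ifP; lra.
- by rewrite le_max lexx.
have /su /= gu : forall p, p \in s -> [set g : Isom U | dist (g p.1) p.2 = dist p.1 p.2] g.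
  move=> p ps /=; have p1A : p.1 \in A by rewrite in_cons mem_cat map_f ?orbT.
  have p2A : p.2 \in A by rewrite in_cons mem_cat (map_f snd) ?orbT.
  by rewrite gA //; apply/max_idPl/ltW; exact: (rA _ _ _ p1A p2A p1A (sP _ ps)).
have := gA u u (mem_head _ _) (mem_head _ _).
by rewrite gu distxx (max_idPr (ltW r0)); lra.
Qed.

(** Adding e up to the cap [M] moves the points of [A] by at most e, yet increases d(u, v), which is
    below [M]. *)
Lemma stationary_not_m u v : 0 < dist u v -> ((dist u v)%:E < b)%E ->
  ~ m_filter [set g | dist (g u) v = dist u v].
Proof.
move=> uv0 uvb [s sP suv]; pose A := u :: v :: map fst s.
have [e [eb e0 es]] : exists e, [/\ Sb S b e, 0 < e & forall p, p \in s -> e < p.2].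
  apply: (scale_near hS); apply: filter_seq => p /sP[_ p0 _].
  exact: nbhs_right_lt.
have [M [Mb M0 _ ltM MA]] := dist_cap hS A (dist u v).
have [x y xA yA|t t' t'' t0 tt|x y xA yA|g gA] :=
  shift_isometry Ury (A := A) (p := fun t => Num.min (t + e) M).
- rewrite /Num.min; case: ifP => // teM; apply: (Sb_lower Mb).
  + by apply: (scaleD hS); [exact: (dist_in _ _).1|exact: eb.1].
  + by have := dist_ge0 x y; lra.
  + exact: ltW.
- by rewrite /Num.min; case: ifP; case: ifP; lra.
- by rewrite le_min MA // andbT; lra.
have /suv /= guv : forall p, p \in s -> [set g : Isom U | dist (g p.1) p.1 <= p.2] g.
  move=> p ps /=; have pA : p.1 \in A by rewrite !in_cons map_f ?orbT.
  by rewrite gA // distxx add0r ge_min (ltW (es _ ps)).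
have uA : u \in A by exact: mem_head.
have vA : v \in A by rewrite in_cons mem_head orbT.
have := gA u v uA vA; rewrite guv; have := ltM _ uvb (lexx _).
by rewrite /Num.min; case: ifP => _; lra.
Qed.

Lemma m_not_trivial : ~ (m_filter `<=` [set setT]).
Proof.
have [u _] := urysohn_inhabited hS Ury; have [r [rb r0 _ _]] := scale_cap hS 0.
have [e [eb e0 er]] : exists e, [/\ Sb S b e, 0 < e & e < r].
  by apply: (scale_near hS); exact: nbhs_right_lt.
move=> /(_ _ (m_filter_gen u eb e0)) /= uT.
have [x y xA yA|t t' t''|x y xA yA|g gA] := shift_isometry Ury (A := [:: u]) (p := fun t => Num.max t r).
- by rewrite /Num.max; case: ifP => // _; exact: dist_in.
- by rewrite /Num.max; case: ifP; case: ifP; lra.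
- by rewrite le_max lexx.
have : [set g : Isom U | dist (g u) u <= e] g by rewrite uT.
by rewrite /= gA ?mem_head // distxx (max_idPr (ltW r0)); lra.
Qed.

Lemma exists_stationary : exists u v, 0 < dist u v /\ ((dist u v)%:E < b)%E.
Proof.
have [u _] := urysohn_inhabited hS Ury; have [r [rb r0 _ _]] := scale_cap hS 0.
have [e [eb e0 er]] : exists e, [/\ Sb S b e, 0 < e & e < r].
  by apply: (scale_near hS); exact: nbhs_right_lt.
have [||w [wu _]] := two_point_extension (u := u) (v := u) eb eb.
- by rewrite subrr normr0 dist_ge0.
- by rewrite distxx; lra.
exists w, u; rewrite wu; split=> //.
by have [_ /andP[_]] := rb; apply: lt_le_trans; rewrite lte_fin.
Qed.

Lemma coarse_filters F : group_filter F -> F `<=` st_filter ->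
  [\/ F = st_filter, F = stationary_filter, F = m_filter | F = [set setT]].
Proof.
move=> gF Fst; have FF := group_filter_filter gF.
have {}Fst' W : F W -> exists A, forall g, fixes A g -> W g.
  by move=> /Fst[A _ AW]; exists A.
have [Fm|nFm] := pselect (forall u e, Sb S b e -> 0 < e -> F [set g | dist (g u) u <= e]); last first.
  apply: Or44; apply/seteqP; split=> [W FW|W ->]; last exact: filterT.
  have [u [e [[_ /andP[_ eb]] e0 uF]]] : exists u e, [/\ Sb S b e, 0 < e & ~ F [set g | dist (g u) u <= e]].
    apply: contrapT => nF; apply: nFm => u e eb e0; apply: contrapT => uF.
    by apply: nF; exists u, e.
  exact: (coarse_trivial hS Ury gF Fst' e0 eb uF).
have mF : m_filter `<=` F.
  apply: subbase_filter_sub => -[u e] [/= Se e0 eb]; apply: Fm => //.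
  by split=> //; rewrite lee_fin ltW.
have [Fz|nFz] := pselect (forall u v, 0 < dist u v -> ((dist u v)%:E < b)%E ->
    F [set g | dist (g u) v = dist u v]); last first.
  apply: Or43; apply/seteqP; split=> // W FW.
  have [u [v [uv0 uvb uvF]]] : exists u v, [/\ 0 < dist u v, ((dist u v)%:E < b)%E &
      ~ F [set g | dist (g u) v = dist u v]].
    apply: contrapT => nF; apply: nFz => u v uv0 uvb; apply: contrapT => uvF.
    by apply: nF; exists u, v.
  have [A [e [eb e0 AW]]] := coarse_of_half_generic hS Ury gF Fst'
    (coarse_half_generic hS Ury gF Fst' Fm uv0 uvb uvF) FW.
  have mFF := group_filter_filter m_group_filter.
  have : m_filter [set g | forall x, x \in A -> dist (g x) x <= e].
    by apply: filter_seq => x _; exact: m_filter_gen.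
  by apply: filterS => g /AW.
have zF : stationary_filter `<=` F.
  by apply: subbase_filter_sub => -[u v] [/= uv0 uvb]; exact: Fz.
have [Fs|nFs] := pselect (forall u, F [set g | g u = u]); last first.
  apply: Or42; apply/seteqP; split=> // W FW.
  have [u uF] : exists u, ~ F [set g | g u = u].
    apply: contrapT => nF; apply: nFs => u; apply: contrapT => uF.
    by apply: nF; exists u.
  have [A [e [eb e0 AW]]] := coarse_not_stabilizer hS Ury gF Fst' uF FW.
  have zFF := group_filter_filter stationary_group_filter.
  have F1 : stationary_filter [set g | forall x, x \in A -> dist (g x) x <= e].
    by apply: filter_seq => x _; apply: m_sub_stationary; exact: m_filter_gen.
  have F2 : stationary_filter [set g | forall x, x \in A -> forall y, y \in A ->
      0 < dist x y -> ((dist x y)%:E < b)%E -> dist (g x) y = dist x y].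
    apply: filter_seq => x _; apply: filter_seq => y _.
    have [[xy0 xyb]|nxy] := pselect (0 < dist x y /\ ((dist x y)%:E < b)%E).
      by apply: filterS (stationary_filter_gen xy0 xyb) => g.
    by apply: filterS filterT => g _ xy0 xyb; case: nxy.
  by apply: filterS (filterI F1 F2) => g [g1 g2]; apply: AW => // x y xA yA; exact: g2.
apply: Or41; apply/seteqP; split=> //.
by apply: subbase_filter_sub => u _; exact: Fs.
Qed.

Lemma tau_stE : tau_st U = topology_of_base st_filter.
Proof.
apply/seteqP; split=> W OW g /OW[V].
  move=> [A /finite_seqP[s ->] <-] VW; exists (stabilizer [set` s]) => //.
  by exists s => // h hs x /= xs; exact: hs.
move=> [s _ sV] VW; exists (stabilizer [set` s]).
  by exists [set` s] => //; exact: finite_seq.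
by move=> h hs; apply/VW/sV => x xs; exact: hs.
Qed.

Lemma tau_mE : tau_m U = topology_of_base m_filter.
Proof.
apply: (generated_topologyE (topology_of_base_group_topology m_group_filter)).
rewrite topology_of_base_nbhs1; apply: etrans (esym (generated_subbase_filter _ _)) _.
congr generated_filter.
apply/seteqP; split=> N [].
  by move=> [u e] [/= Se e0 eb] <-; exists u, e.
by move=> u [e [Se e0 eb ->]]; exists (u, e).
Qed.

Lemma stationary_filterE :
  generated_filter (@stationary_sets _ _ _ U) = all_stationary_filter.
Proof.
rewrite /all_stationary_filter -generated_subbase_filter; congr generated_filter.
apply/seteqP; split=> N [].
  by move=> u [v [uv0 ->]]; exists (u, v).
by move=> [u v] /= uv0 <-; exists u, v.
Qed.

(** A group filter inside [all_stationary_filter] is one of the four by [coarse_filters]; it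
    contains no point stabilizer, so it is not [st_filter], and the other three lie inside
    [stationary_filter]. *)
Lemma tau_0p0E : tau_0p0 U = topology_of_base stationary_filter.
Proof.
apply/seteqP; split=> [W [Q [Qt [Qgrp Q1]] QW]|W QW]; last first.
  exists (topology_of_base stationary_filter) => //.
  exists (topology_of_base_is_topology stationary_group_filter).
  split; first exact: topology_of_base_group_topology.
  rewrite stationary_filterE => V /=.
  by rewrite topology_of_base_nbhs1; exact: stationary_sub_all.
have [gF QE] := group_topology_filter Qgrp; move: gF QE Q1 QW.
set F := nbhs _ => gF -> F1.
suff Fz : F `<=` stationary_filter.
  exact: ((topology_of_base_sub gF stationary_group_filter).2 Fz W).
have {}F1 : F `<=` all_stationary_filter by rewrite -stationary_filterE.
have [FE|->|->|->] := coarse_filters gF (subset_trans F1 all_stationary_sub_st).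
- have [u _] := urysohn_inhabited hS Ury; case: (@stabilizer_not_stationary u).
  by apply: F1; rewrite FE; exact: subbase_filter_gen.
- by [].
- exact: m_sub_stationary.
- have FF := group_filter_filter stationary_group_filter.
  by move=> V ->; exact: filterT.
Qed.

End FourTopologies.

Theorem theoremD (R : realType) (S : set R) (b : \bar R) (U : metricSpace S b) :
  zmod_closed (mem S) -> dense S ->
  (exists2 b0 : R, S b0 /\ 0 < b0 & b = b0%:E) \/ b = +oo%E ->
  urysohn U ->
  [set O : set_system (Isom U) | group_topology O /\ O `<=` tau_st U] =
    [set tau_st U; tau_0p0 U; tau_m U; [set set0; setT]] /\
  [/\ tau_0p0 U `<` tau_st U, tau_m U `<` tau_0p0 U &
      [set set0; setT] `<` tau_m U].
Proof.
move=> Szmod Sdense Stop Ury; have hS := DenseScale Szmod Sdense Stop.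
have gs := st_group_filter U; have gz := stationary_group_filter hS Ury.
have gm := m_group_filter U hS; have gt := set1T_group_filter (Isom U).
have zs : stationary_filter (U := U) `<=` @st_filter _ _ _ U.
  exact: subset_trans (@stationary_sub_all _ _ _ U) (@all_stationary_sub_st _ _ _ U).
have mz := m_sub_stationary hS Ury.
have tm : [set setT] `<=` @m_filter _ _ _ U.
  have FF := group_filter_filter gm.
  by move=> V ->; exact: filterT.
rewrite tau_stE (tau_mE U hS) (tau_0p0E hS Ury) -topology_of_base_set1T; split.
  have top F : group_filter F -> F `<=` @st_filter _ _ _ U ->
      group_topology (topology_of_base F) /\
      topology_of_base F `<=` topology_of_base (@st_filter _ _ _ U).
    move=> gF Fs; split; last exact/topology_of_base_sub.
    by eexists; exact: (topology_of_base_group_topology gF).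
  apply/seteqP; split=> Q.
    move=> [[Qt Qgrp]]; have [gF ->] := group_topology_filter Qgrp.
    move=> /(topology_of_base_sub gF gs)/(coarse_filters hS Ury gF)[] ->.
    - by left; left; left.
    - by left; left; right.
    - by left; right.
    - by right.
  move=> [[[->|->]|->]|->]; apply: top => //.
  - exact: subset_trans mz zs.
  - exact: subset_trans tm (subset_trans mz zs).
split; apply: topology_of_base_proper => //.
- move=> sz; have [u _] := urysohn_inhabited hS Ury.
  apply: (stabilizer_not_stationary hS Ury (u := u)).
  by apply/stationary_sub_all/sz; exact: subbase_filter_gen.
- move=> zm; have [u [v [uv0 uvb]]] := exists_stationary hS Ury.
  by apply: (stationary_not_m hS Ury uv0 uvb); apply: zm; exact: stationary_filter_gen.
- exact: m_not_trivial.
Qed.
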